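(* Let $d\in\mathbb N^+$, $\lambda>0$ and $\alpha=\lambda=\mu$. Let $P(k,t)$ be the probability that the process $\mathcal N$ (defined in the context), started at the origin, is at time $t$ in the $k$-th state of any semiaxis. Then for $k\in\mathbb N^+$ and $0<t<1/\lambda$, $$P(k,t)=\frac{(\lambda t)^k}{(\lambda t+1)^{k+1}}\left\{d+(d-1)\sum_{n=1}^{+\infty}\frac{(-\lambda t)^n}{n!}\sum_{j=1}^n t_{n,j}\,d^j\sum_{r=0}^{+\infty}\frac{(n)_r}{(n+1)_r}\left(1-\frac{1}{1+\lambda t}\right)^r{}_2F_1\!\left(-r,-k;1;-\frac{1}{\lambda t}\right)\right\},$$ where $t_{n,j}$ is the number of permutations of $\{1,\ldots,n\}$ with $j$ components and ${}_2F_1$ is the Gauss hypergeometric function.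
   Context: Let $D=\{1,\ldots,d\}$. $\mathcal N=\{(N(t),J(t)),t\ge 0\}$ is the (nonexplosive) continuous-time Markov chain on $S=\{(0,0)\}\cup(\mathbb N^+\times D)$ whose only nonzero off-diagonal transition rates are, for $k\in\mathbb N^+$ and $j\in D$: from $(0,0)$ to $(1,j)$ at rate $\alpha$; from $(k,j)$ to $(k+1,j)$ at rate $\alpha+\lambda k$; from $(k,j)$ to $(k-1,j)$ at rate $\mu k$, where $(0,j)$ is identified with $(0,0)$ for every $j$. The initial state is $0:=(0,0)$. Put $p(k,j,t)=\mathbb P\{(N(t),J(t))=(k,j)\mid (N(0),J(0))=0\}$ and $P(k,t)=\sum_{j=1}^d p(k,j,t)$ for $k\in\mathbb N^+$. A permutation is indecomposable if its one-line notation cannot be split into two (nonempty) parts such that every number in the first part is smaller than every number in the second part; the number of components of a permutation is the number of blocks in its finest splitting into consecutive parts such that every number in an earlier part is smaller than every number in a later part. The numbers $t_{n,k}$ ($n\ge1$, $k\ge 1$; $t_{n,k}=0$ if $n<k$) satisfy $t_{n,1}=n!-\sum_{j=1}^{n-1}(n-j)!\,t_{j,1}$ and $t_{n,k}=\sum_{j=1}^{n-k+1}t_{j,1}\,t_{n-j,k-1}$ for $2\le k\le n$. ${}_2F_1(a,b;c;x)=\sum_{n\ge0}\frac{(a)_n(b)_n}{(c)_n}\frac{x^n}{n!}$, with $(a)_n=a(a+1)\cdots(a+n-1)$, $(a)_0=1$ (a finite sum when $a$ or $b$ is a nonpositive integer). *)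

(* Defs.v *)
From HB Require Import structures.
From mathcomp Require Import all_boot all_order all_algebra all_fingroup.
From mathcomp Require Import all_classical all_reals all_analysis.

Set Implicit Arguments.
Unset Strict Implicit.
Unset Printing Implicit Defensive.

Import Order.TTheory GRing.Theory Num.Theory.
Import numFieldNormedType.Exports.

Local Open Scope classical_set_scope.
Local Open Scope ring_scope.

Section MarkovChains.
Context {R : realType} {S : countType}.

(* Honest (total mass 1) transition functions: the nonexplosive case. *)
Record is_transition_function (p : R -> S -> S -> R) : Prop := {
  tf_ge0 : forall t x y, 0 <= t -> 0 <= p t x y ;
  tf_mass1 : forall t x, 0 <= t -> \esum_(y in [set: S]) (p t x y)%:E = 1%E ;
  tf_start : forall x y, p 0 x y = (x == y)%:R ;
  tf_chapman_kolmogorov : forall s t x y, 0 <= s -> 0 <= t ->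
    (p (s + t) x y)%:E = \esum_(z in [set: S]) (p s x z * p t z y)%:E }.

(* Only the off-diagonal values of [q] matter.  The sum over [y != x] is a
   finite-support sum: [q x] is meant to be finitely supported for each [x]. *)
Definition exit_rate (q : S -> S -> R) (x : S) : R :=
  \sum_(y \in [set y | y != x]) q x y.

Record has_transition_rates (q : S -> S -> R) (p : R -> S -> S -> R) : Prop := {
  rates_off_diagonal : forall x y, x != y ->
    p h x y / h @[h --> 0^'+] --> q x y ;
  rates_diagonal : forall x,
    (1 - p h x x) / h @[h --> 0^'+] --> exit_rate q x }.

Context {disp : measure_display} {T : measurableType disp}.

(* The Markov property is stated multiplied out, so that conditioning on a null
   event imposes nothing.  Only the times [t >= 0] are constrained. *)
Record is_markov_chain (P : probability T R) (X : R -> T -> S)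
    (q : S -> S -> R) (x0 : S) : Prop := {
  mc_measurable : forall t x, 0 <= t -> measurable [set w | X t w = x] ;
  mc_initial : P [set w | X 0 w = x0] = 1%E ;
  mc_markov : exists p : R -> S -> S -> R,
    [/\ is_transition_function p,
        has_transition_rates q p &
        forall (n : nat) (s : nat -> R) (x : nat -> S),
          0 <= s 0%N -> (forall i, (i <= n)%N -> s i < s i.+1) ->
          P [set w | forall i, (i <= n.+1)%N -> X (s i) w = x i] =
          (P [set w | forall i, (i <= n)%N -> X (s i) w = x i]
             * (p (s n.+1 - s n) (x n) (x n.+1))%:E)%E ] }.

Definition cond_prob (P : probability T R) (A B : set T) : R :=
  fine (P (A `&` B)) / fine (P B).

End MarkovChains.

(* The state space {(0,0)} U (N^+ x D): [None] is (0,0), [Some (k, j)] is the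
   point (k+1, j) of the semiaxis [j]. *)
Definition state (d : nat) : countType := option (nat * 'I_d).

Definition origin (d : nat) : state d := None.

(* (k, j), with (0, j) identified with (0, 0). *)
Definition ray_point (d : nat) (k : nat) (j : 'I_d) : state d :=
  if k is k'.+1 then Some (k', j) else None.

Definition rate {R : realType} (d : nat) (alpha lambda mu : R)
    (x y : state d) : R :=
  match x with
  | None => if [exists j : 'I_d, y == ray_point 1 j] then alpha else 0
  | Some (k', j) =>
      let k := k'.+1 in
      if y == ray_point k.+1 j then alpha + lambda * k%:R
      else if y == ray_point k.-1 j then mu * k%:R
      else 0
  end.

Section StateProbabilities.
Context {R : realType} {disp : measure_display} {T : measurableType disp}.

Definition state_prob (P : probability T R) (d : nat) (X : R -> T -> state d)
    (k : nat) (j : 'I_d) (t : R) : R :=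
  cond_prob P [set w | X t w = ray_point k j] [set w | X 0 w = origin d].

Definition level_prob (P : probability T R) (d : nat) (X : R -> T -> state d)
    (k : nat) (t : R) : R :=
  \sum_(j < d) state_prob P X k j t.

End StateProbabilities.

(* A splitting of the word s(0) ... s(n-1) into consecutive nonempty parts is
   encoded by the set [B] of the first positions of its parts, so that it has
   [#|B|] parts; [i] is in an earlier part than [j] iff some part starts in
   ]i, j]. *)
Definition ordered_splitting (n : nat) (s : 'S_n) (B : {set 'I_n}) : bool :=
  [forall i : 'I_n, (i == 0%N :> nat) ==> (i \in B)] &&
  [forall i : 'I_n, forall j : 'I_n,
     [exists b in B, (i < b)%N && (b <= j)%N] ==> (s i < s j)%N].

(* The finest splitting is the one with the largest number of parts. *)
Definition components (n : nat) (s : 'S_n) : nat :=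
  \max_(B : {set 'I_n} | ordered_splitting s B) #|B|.

Definition perm_components (n k : nat) : nat :=
  #|[pred s : 'S_n | components s == k]|.

Definition pochhammer {R : realType} (a : R) (n : nat) : R :=
  \prod_(i < n) (a + i%:R).

Definition hypergeometric2F1 {R : realType} (a b c x : R) : R :=
  \big[+%R/0]_(0 <= n <oo)
    (pochhammer a n * pochhammer b n / pochhammer c n * (x ^+ n / n`!%:R)).

(* Below, [x] stands for lambda t. *)
Definition inner_term {R : realType} (x : R) (k n r : nat) : R :=
  pochhammer n%:R r / pochhammer (n.+1)%:R r * (1 - 1 / (1 + x)) ^+ r
  * hypergeometric2F1 (- r%:R) (- k%:R) 1 (- (1 / x)).

Definition outer_term {R : realType} (x : R) (d k n : nat) : R :=
  (- x) ^+ n / n`!%:R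
  * (\sum_(1 <= j < n.+1) (perm_components n j)%:R * d%:R ^+ j)
  * \big[+%R/0]_(0 <= r <oo) inner_term x k n r.

(* Main.v *)
Require Import Defs.
From HB Require Import structures.
From mathcomp Require Import all_boot all_order all_algebra all_fingroup.
From mathcomp Require Import all_classical all_reals all_analysis.
From mathcomp Require Import zify ring lra.
Set Implicit Arguments.
Unset Strict Implicit.
Unset Printing Implicit Defensive.
Import Order.TTheory GRing.Theory Num.Theory.
Import numFieldNormedType.Exports.
Local Open Scope classical_set_scope.
Local Open Scope ring_scope.


(** Scale time so that [lambda = 1] and put [g_m(u) = u^m / (1 + u)^(m+1)] and
    [a_n = sum_j t_{n,j} d^j].  Let [I_{n,m}] be the [n]-fold primitive of [g_m]
    vanishing at [0], and
      [W_m = g_m + (d - 1)/d * sum_{n >= 1} (-1)^n a_n I_{n,m}].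

    Classifying the permutations of [N] letters by the cuts of their finest
    splitting gives [a_N = d N! + (d - 1) sum_{1 <= n < N} a_n (N - n)!], and
    this recurrence is exactly what makes [W] solve the equation that the jump
    rates impose on the levels of the rays, with [W_m(0) = [m = 0]].  The rates
    are symmetric, so by the backward equation the sum over the states [z] of
    [p(s, z, y) W_{|z|}(t - s)] does not depend on [s]; comparing [s = 0] with
    [s = t] gives [p(t, 0, y) = W_k(t)] for each of the [d] states [y] of level
    [k].  To avoid exchanging limits, the series is truncated at [n = K] and the
    sum over levels at [M]: the boundary term decays like [M / 2^M], and the
    defect of the truncated equation is at most [(d - 1) a_{K+1} u^K / K!], which
    tends to [0] for [u < 1].  Finally [n! I_{n,k}(x)] is the integral of
    [n (x - s)^(n-1) g_k(s)] over [0 <= s <= x], and expanding [g_k(s)] in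
    powers of [(x - s)/(1 + x)] (the generating function of the Meixner
    polynomials) turns it into the inner series. *)


(** * Components of permutations *)

(** The position is a natural number and not an ordinal, so that cuts of a direct sum and of its
    first summand can be compared. Position [0] is vacuously a cut and accounts for the first
    part. *)
Definition is_cut (n : nat) (s : 'S_n) (b : nat) : bool :=
  [forall i : 'I_n, forall j : 'I_n, (i < b <= j)%N ==> (s i < s j)%N].

Lemma is_cutP (n : nat) (s : 'S_n) (b : nat) :
  reflect (forall i j : 'I_n, (i < b)%N -> (b <= j)%N -> (s i < s j)%N)
          (is_cut s b).
Proof.
apply: (iffP forallP) => [h i j ib bj|h i].
  by have /forallP/(_ j)/implyP := h i; apply; rewrite ib.
by apply/forallP => j; apply/implyP => /andP[]; exact: h.
Qed.

Lemma is_cut0 (n : nat) (s : 'S_n) : is_cut s 0.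
Proof. by apply/is_cutP. Qed.

(** Every part of a splitting starts at a cut, and the set of all cuts below [n] is itself a
    splitting, so the maximum is reached there. *)
Lemma componentsE (n : nat) (s : 'S_n) :
  components s = count (is_cut s) (iota 0 n).
Proof.
transitivity #|[set b : 'I_n | is_cut s b]|%SET; last first.
  rewrite -sum1_card -sum1_count -[n in iota 0 n]subn0 -[RHS]/(\sum_(0 <= b < n | is_cut s b) 1)%N.
  by rewrite big_mkord; apply: eq_bigl => b; rewrite inE.
apply/eqP; rewrite eqn_leq; apply/andP; split.
  apply/bigmax_leqP => B /andP[_ /forallP sB].
  apply/subset_leq_card/fintype.subsetP => b bB; rewrite inE.
  apply/is_cutP => i j ib bj.
  have /forallP/(_ j)/implyP := sB i; apply.
  by apply/existsP; exists b; rewrite bB ib.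
apply: (@leq_bigmax_cond _ _ (fun B : {set 'I_n} => #|B|)%SET).
apply/andP; split; first by apply/forallP => i; apply/implyP => /eqP i0; rewrite inE i0 is_cut0.
apply/forallP => i; apply/forallP => j; apply/implyP => /existsP[b].
by rewrite inE => /andP[/is_cutP cb /andP[]]; exact: cb.
Qed.

(** For [n > 0] this is the coefficient [a_n] of the series. At [n = 0] it equals [1], while the sum
    over [1 <= j <= n] is empty. *)
Definition cut_weight (d n : nat) : nat := \sum_(s : 'S_n) d ^ components s.

Lemma perm_components_sum (d n : nat) : (0 < n)%N ->
  (\sum_(1 <= j < n.+1) perm_components n j * d ^ j)%N = cut_weight d n.
Proof.
move=> n0; rewrite /cut_weight big_add1 big_mkord.
have comp_gt0 (s : 'S_n) : (0 < components s <= n)%N.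
  rewrite componentsE -has_count; apply/andP; split; last first.
    by rewrite -[X in (_ <= X)%N](size_iota 0 n) count_size.
  by apply/hasP; exists 0%N; rewrite ?is_cut0 // mem_iota.
have pf (s : 'S_n) : ((components s).-1 < n)%N by have := comp_gt0 s; lia.
rewrite (partition_big (fun s : 'S_n => Ordinal (pf s)) predT) //=.
apply: eq_bigr => j _; rewrite /perm_components -sum1_card big_distrl /=.
apply: eq_big => [s|s /eqP ->]; last by rewrite mul1n.
rewrite unfold_in /= -val_eqE /=; have := comp_gt0 s; lia.
Qed.

(** The direct sum of two permutations; the permutations of [b + c] letters with a cut at [b] are
    exactly of this form. *)
Definition dsum_fun (b c : nat) (s : 'S_b) (s' : 'S_c) (i : 'I_(b + c)) : 'I_(b + c) :=
  match fintype.split i with inl j => lshift c (s j) | inr j => rshift b (s' j) end.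

Lemma dsum_fun_inj (b c : nat) (s : 'S_b) (s' : 'S_c) : injective (dsum_fun s s').
Proof.
move=> i j; rewrite /dsum_fun.
rewrite -{2}(splitK i) -{2}(splitK j).
case: (fintype.split i) => i'; case: (fintype.split j) => j' /=.
- by move/lshift_inj/perm_inj ->.
- by move/eqP; rewrite eq_lrshift.
- by move/eqP; rewrite eq_rlshift.
- by move/rshift_inj/perm_inj ->.
Qed.

Definition dsum (b c : nat) (s : 'S_b) (s' : 'S_c) : 'S_(b + c) :=
  perm (@dsum_fun_inj b c s s').

Lemma dsumL (b c : nat) (s : 'S_b) (s' : 'S_c) i : dsum s s' (lshift c i) = lshift c (s i).
Proof. by rewrite permE /dsum_fun (unsplitK (inl i)). Qed.

Lemma dsumR (b c : nat) (s : 'S_b) (s' : 'S_c) i : dsum s s' (rshift b i) = rshift b (s' i).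
Proof. by rewrite permE /dsum_fun (unsplitK (inr i)). Qed.

Lemma dsum_inj (b c : nat) (s1 s2 : 'S_b) (s1' s2' : 'S_c) :
  dsum s1 s1' = dsum s2 s2' -> s1 = s2 /\ s1' = s2'.
Proof.
move=> e; split; apply/permP => i.
  by apply: (@lshift_inj b c); rewrite -(dsumL s1 s1') e dsumL.
by apply: (@rshift_inj b c); rewrite -(dsumR s1) e dsumR.
Qed.

Lemma is_cut_dsum (b c : nat) (s : 'S_b) (s' : 'S_c) : is_cut (dsum s s') b.
Proof.
apply/is_cutP => i j; case: (split_ordP i) => i' ->; case: (split_ordP j) => j' ->;
  rewrite ?dsumL ?dsumR /= => ib bj; try by move: (ltn_ord i') (ltn_ord j') ib bj; lia.
by have := ltn_ord (s i'); lia.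
Qed.

Lemma is_cut_dsumL (b c : nat) (s : 'S_b) (s' : 'S_c) (i : nat) : (i < b)%N ->
  is_cut (dsum s s') i = is_cut s i.
Proof.
move=> ib; apply/is_cutP/is_cutP => h p q pi iq.
  by have := h (lshift c p) (lshift c q) pi iq; rewrite !dsumL.
case: (split_ordP p) pi => p' -> /= pi; last lia.
case: (split_ordP q) iq => q' -> /= iq; rewrite ?dsumL ?dsumR /=; first exact: h.
by have := ltn_ord (s p'); lia.
Qed.

Lemma card_ord_lt (n m : nat) : (m <= n)%N -> #|[set v : 'I_n | (v < m)%N]%SET| = m.
Proof.
move=> mn; rewrite -sum1_card (eq_bigl (fun v : 'I_n => (v < m)%N)).
  by rewrite (big_ord_narrow mn) sum1_card card_ord.
by move=> v; rewrite inE.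
Qed.

(** Pigeonhole: if a position before the cut had a value at least [b], the [c] values after the cut
    would all exceed it, yet fewer than [c] values do. The other side is symmetric, so both blocks
    are preserved. *)
Lemma cut_dsum (b c : nat) (u : 'S_(b + c)) : is_cut u b ->
  exists s s', u = @dsum b c s s'.
Proof.
move/is_cutP => cu.
have uL (i : 'I_b) : (u (lshift c i) < b)%N.
  rewrite ltnNge; apply/negP => bu.
  have : (#|[set u (rshift b j) | j : 'I_c]%SET| <= #|[set v : 'I_(b + c) | (u (lshift c i) < v)%N]%SET|)%N.
    apply/subset_leq_card/fintype.subsetP => v /imsetP[j _ ->]; rewrite inE.
    by apply: cu => /=; [exact: ltn_ord|exact: leq_addr].
  rewrite card_imset; last by move=> j j' /perm_inj/rshift_inj.
  rewrite card_ord => /(leq_ltn_trans)-/(_ c); rewrite ltnn => hc.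
  suff : false by []. apply: hc.
  have -> : [set v : 'I_(b + c) | (u (lshift c i) < v)%N]%SET =
      ~: [set v : 'I_(b + c) | (v < (u (lshift c i)).+1)%N]%SET.
    by apply/setP => v; rewrite !inE; lia.
  rewrite cardsCs finset.setCK card_ord.
  have := ltn_ord (u (lshift c i)) => lt.
  by rewrite card_ord_lt //; lia.
have uR (j : 'I_c) : (b <= u (rshift b j))%N.
  rewrite leqNgt; apply/negP => ub.
  have : (#|[set u (lshift c i) | i : 'I_b]%SET| <= #|[set v : 'I_(b + c) | (v < u (rshift b j))%N]%SET|)%N.
    apply/subset_leq_card/fintype.subsetP => v /imsetP[i _ ->]; rewrite inE.
    by apply: cu => /=; [exact: ltn_ord|exact: leq_addr].
  rewrite card_imset; last by move=> i i' /perm_inj/lshift_inj.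
  by rewrite card_ord card_ord_lt; have := ltn_ord (u (rshift b j)); lia.
have injL : injective (fun i => Ordinal (uL i)).
  by move=> i i' /(congr1 val) /= /val_inj/perm_inj/lshift_inj.
have uR' (j : 'I_c) : (u (rshift b j) - b < c)%N.
  by have := ltn_ord (u (rshift b j)); have := uR j; lia.
have injR : injective (fun j => Ordinal (uR' j)).
  move=> j j' /(congr1 val) /= e; apply/(@rshift_inj b)/(@perm_inj _ u)/val_inj.
  by have := uR j; have := uR j'; move: e => /=; lia.
exists (perm injL), (perm injR); apply/permP => i; apply/val_inj.
case: (split_ordP i) => i' ->; rewrite ?dsumL ?dsumR !permE //=.
by have := uR i'; lia.
Qed.

(** The cuts before [b] of a direct sum are those of its first summand, so the second summand is
    free and contributes [c!]. *)
Lemma cut_weight_cut (d b c : nat) :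
  (\sum_(u : 'S_(b + c) | is_cut u b) d ^ count (is_cut u) (iota 0 b))%N =
  (cut_weight d b * c`!)%N.
Proof.
(* The inverse of the direct sum is found by search; its default value is never reached on
   permutations with a cut at [b]. *)
rewrite (reindex_onto (fun p : 'S_b * 'S_c => dsum p.1 p.2)
  (fun u => odflt (1%g, 1%g) [pick p : 'S_b * 'S_c | dsum p.1 p.2 == u])) /=; last first.
  move=> u /cut_dsum[s [s' us]]; case: pickP => [p /eqP//|/(_ (s, s'))].
  by rewrite us eqxx.
rewrite (eq_bigl predT); last first.
  move=> [s s']; rewrite is_cut_dsum /=; case: pickP => [[p p'] /= /eqP/dsum_inj[-> ->]|/(_ (s, s'))].
    by rewrite eqxx.
  by rewrite eqxx.
rewrite -(pair_bigA _ (fun (s : 'S_b) (s' : 'S_c) => d ^ count (is_cut (dsum s s')) (iota 0 b)))%N /=.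
rewrite /cut_weight big_distrl /=; apply: eq_bigr => s _.
rewrite (eq_bigr (fun=> d ^ components s)%N) => [|s' _].
  by rewrite sum_nat_const card_Sn mulnC.
rewrite componentsE; congr (_ ^ _)%N; apply: eq_in_count => i.
by rewrite mem_iota => /andP[_]; exact: is_cut_dsumL.
Qed.

(** Telescoping: each position satisfying [c] multiplies the power by [d], that is, adds [d - 1]
    times the power reached before it. *)
Lemma expn_count (d : nat) (c : pred nat) (n : nat) : (0 < d)%N ->
  (d ^ count c (iota 0 n) =
   1 + d.-1 * \sum_(0 <= b < n | c b) d ^ count c (iota 0 b))%N.
Proof.
move=> d0; elim: n => [|n IH]; first by rewrite big_geq // muln0.
rewrite -addn1 iotaD count_cat /= add0n addn0 addn1 big_mkcond big_nat_recr //= -big_mkcond /=.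
rewrite mulnDr addnA -IH; case: (c n); rewrite ?addn0 ?muln0 ?addn0 //.
by rewrite addn1 expnS -mulSn prednK.
Qed.

(* [d^p = d + (d - 1) (d + ... + d^(p-1))], where [d^(i-1)] is charged to the
   [i]-th cut: it only depends on the part of the word before that cut. *)
Lemma cut_weight_rec (d n : nat) : (0 < d)%N -> (0 < n)%N ->
  cut_weight d n =
  (d * n`! + d.-1 * \sum_(1 <= b < n) cut_weight d b * (n - b)`!)%N.
Proof.
move=> d0 n0.
have cE (s : 'S_n) : (d ^ components s = d + d.-1 *
    \sum_(1 <= b < n) if is_cut s b then d ^ count (is_cut s) (iota 0 b) else 0)%N.
  rewrite componentsE expn_count // big_mkcond big_ltn // is_cut0 /= mulnDr.
  by rewrite muln1 addnA add1n prednK.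
rewrite {1}/cut_weight (eq_bigr _ (fun s _ => cE s)).
rewrite big_split /= sum_nat_const card_Sn mulnC; congr (_ + _)%N.
rewrite -big_distrr /= exchange_big /=; congr (_ * _)%N.
apply: eq_big_nat => b /andP[_ bn]; rewrite -big_mkcond /=.
have [c ->] : exists c, n = (b + c)%N by exists (n - b)%N; lia.
by rewrite cut_weight_cut addKn.
Qed.

Lemma sum_bin_diag (p n : nat) :
  (\sum_(0 <= b < n) 'C(b + p, p) = 'C(n + p, p.+1))%N.
Proof.
elim: n => [|n IH]; first by rewrite big_geq // bin_small.
by rewrite big_nat_recr //= IH addSn binS addnC.
Qed.

Lemma leq_bin (n b : nat) : (0 < b < n)%N -> (n <= 'C(n, b))%N.
Proof.
elim: n b => [|n IH] [|b] //=; rewrite ltnS => bn.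
rewrite binS; move: bn; rewrite leq_eqVlt => /orP[/eqP <-|bn].
  by rewrite binn binSn.
have := IH b.+1 bn; have : (0 < 'C(n, b))%N by rewrite bin_gt0; lia.
lia.
Qed.

(** Up to a polynomial factor [a_n] grows like [n!], which gives the radius of convergence [1].
    Strong induction on the recurrence uses [n b! (n - b)! <= n!] for [0 < b < n], then sums the
    binomials along a diagonal. *)
Lemma cut_weight_le (d n : nat) : (0 < d)%N -> (0 < n)%N ->
  (cut_weight d n <= d ^ 2 * n`! * 'C(n + d.-1, d.-1))%N.
Proof.
move=> d0; elim/ltn_ind: n => n IH n0.
set p := d.-1; have dp : d = p.+1 by rewrite /p; lia.
(* The factor [d n] clears the division in [d 'C(n + p, p.+1) = n 'C(n + p, p)], the identity that
   closes the induction. *)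
rewrite -(leq_pmul2l n0) -(leq_pmul2l d0) cut_weight_rec // -/p.
have step : (n * (\sum_(1 <= b < n) cut_weight d b * (n - b)`!) <=
    d ^ 2 * n`! * 'C(n + p, p.+1))%N.
  rewrite -sum_bin_diag !big_distrr /= [leqRHS](@big_ltn _ _ _ 0) //.
  apply: leq_trans (leq_addl _ _); rewrite !big_nat.
  apply: leq_sum => b /andP[b0 bn].
  have := IH b bn b0; rewrite -/p => cb.
  have fb : (n * (b`! * (n - b)`!) <= n`!)%N.
    rewrite -(@bin_fact n b) ?(ltnW bn) // leq_mul2r leq_bin ?b0 //.
    by rewrite orbT.
  apply: (@leq_trans (n * ((d ^ 2 * b`! * 'C(b + p, p)) * (n - b)`!)))%N.
    by rewrite leq_mul2l leq_mul2r cb !orbT.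
  apply: (@leq_trans (d ^ 2 * (n * (b`! * (n - b)`!)) * 'C(b + p, p)))%N.
    by rewrite leq_eqVlt; apply/orP; left; apply/eqP; ring.
  by rewrite leq_mul2r leq_mul2l fb !orbT.
have binE : (d * 'C(n + p, p.+1) = n * 'C(n + p, p))%N.
  by rewrite dp mul_bin_left addnK.
have C0 : (0 < 'C(n + p, p))%N by rewrite bin_gt0 leq_addl.
rewrite mulnDr mulnDr.
apply: (@leq_trans (n * (d ^ 2 * n`!) * 'C(n + p, p) + p * (d ^ 2 * n`! * (d * 'C(n + p, p.+1)))))%N.
  apply: leq_add.
    apply: (@leq_trans (n * (d ^ 2 * n`!)))%N; last exact: leq_pmulr.
    by rewrite leq_eqVlt; apply/orP; left; apply/eqP; ring.
  apply: (@leq_trans (d * p * (n * (\sum_(1 <= b < n) cut_weight d b * (n - b)`!))))%N.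
    by rewrite leq_eqVlt; apply/orP; left; apply/eqP; ring.
  apply: (@leq_trans (d * p * (d ^ 2 * n`! * 'C(n + p, p.+1))))%N; first by rewrite leq_mul2l step orbT.
  by rewrite leq_eqVlt; apply/orP; left; apply/eqP; ring.
by rewrite binE leq_eqVlt; apply/orP; left; apply/eqP; rewrite dp; ring.
Qed.

(** * Binomial series and calculus on a segment *)

Section BinomialSeries.
Context {R : realType}.

(** Pascal's rule, summed; the last term is the truncation error of [(1 - w) S_(i+1) = w S_i]. *)
Lemma series_binE (w : R) (i n : nat) :
  (1 - w) * series (fun r => 'C(r, i.+1)%:R * w ^+ r) n =
  w * series (fun r => 'C(r, i)%:R * w ^+ r) n - 'C(n, i.+1)%:R * w ^+ n.
Proof.
elim: n => [|n IH]; first by rewrite /series /= !big_geq // bin0n !mulr0 mul0r subrr.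
by rewrite !seriesSr !mulrDr IH binS natrD exprS; ring.
Qed.

(** In [series_binE] the error has a favourable sign, so the partial sums increase and are bounded.
    Convergence then forces the error itself to [0], and the identity passes to the limit. *)
Lemma cvg_series_bin (w : R) (i : nat) : 0 <= w < 1 ->
  series (fun r => 'C(r, i)%:R * w ^+ r) @ \oo --> w ^+ i / (1 - w) ^+ i.+1.
Proof.
move=> /andP[w0 w1]; have w1_gt0 : 0 < 1 - w by rewrite subr_gt0.
elim: i => [|i IH].
  rewrite expr0 expr1 (_ : (fun r => _) = geometric 1 w); last first.
    by apply/funext => r; rewrite /geometric /= bin0.
  by apply: cvg_geometric_series; rewrite ger0_norm.
have nd j : {homo series (fun r => 'C(r, j)%:R * w ^+ r) : n m / (n <= m)%N >-> n <= m}.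
  by apply: nondecreasing_series => n _ _; rewrite mulr_ge0 ?exprn_ge0.
have SE n : series (fun r => 'C(r, i.+1)%:R * w ^+ r) n =
    (1 - w)^-1 * (w * series (fun r => 'C(r, i)%:R * w ^+ r) n - 'C(n, i.+1)%:R * w ^+ n).
  by rewrite -series_binE mulKf // gt_eqF.
have cS : cvgn (series (fun r => 'C(r, i.+1)%:R * w ^+ r)).
  apply: nondecreasing_is_cvgn; first exact: nd.
  exists ((1 - w)^-1 * (w * (w ^+ i / (1 - w) ^+ i.+1))) => _ [n _ <-].
  rewrite SE ler_pM2l ?invr_gt0 // lerBlDr ler_wpDr ?mulr_ge0 ?exprn_ge0 //.
  rewrite ler_wpM2l // -(cvg_lim (@Rhausdorff _) IH); apply: nondecreasing_cvgn_le.
    exact: nd.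
  by apply/cvg_ex; exists (w ^+ i / (1 - w) ^+ i.+1).
have t0 := cvg_series_cvg_0 cS.
rewrite (_ : series _ = fun n => (1 - w)^-1 * (w * series (fun r => 'C(r, i)%:R * w ^+ r) n
    - 'C(n, i.+1)%:R * w ^+ n)); last by apply/funext => n; exact: SE.
have -> : w ^+ i.+1 / (1 - w) ^+ i.+2 = (1 - w)^-1 * (w * (w ^+ i / (1 - w) ^+ i.+1) - 0).
  rewrite !exprS; field.
  by rewrite expf_neq0 ?gt_eqF.
by apply: cvgMr; apply: cvgB => //; exact: cvgMr.
Qed.

Lemma cvg_bin_exp (w : R) (i : nat) : 0 <= w < 1 ->
  (fun r => 'C(r, i)%:R * w ^+ r) @ \oo --> (0 : R).
Proof.
by move=> w01; apply: cvg_series_cvg_0; apply/cvg_ex; eexists; exact: cvg_series_bin.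
Qed.

End BinomialSeries.

(** * Derivatives and mean value estimates on a segment *)

Section Derivatives.
Context {R : realType}.
Implicit Types (f g : R -> R) (a b c x : R).

Lemma is_derive_funcst c x : is_derive x 1 (fun _ : R => c) (0 : R).
Proof. exact: is_derive_cst. Qed.

Lemma is_derive_funD f g x a b : is_derive x 1 f a -> is_derive x 1 g b ->
  is_derive x 1 (fun y => f y + g y) (a + b).
Proof. by move=> fa gb; exact: is_deriveD. Qed.

Lemma is_derive_funB f g x a b : is_derive x 1 f a -> is_derive x 1 g b ->
  is_derive x 1 (fun y => f y - g y) (a - b).
Proof. by move=> fa gb; exact: is_deriveB. Qed.

Lemma is_derive_funM f g x a b : is_derive x 1 f a -> is_derive x 1 g b ->
  is_derive x 1 (fun y => f y * g y) (a * g x + f x * b).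
Proof.
move=> fa gb; have := is_deriveM fa gb; rewrite /GRing.scale /=.
by rewrite addrC (mulrC (g x)).
Qed.

Lemma is_derive_funZ c f x a : is_derive x 1 f a ->
  is_derive x 1 (fun y => c * f y) (c * a).
Proof.
move=> fa; have := is_derive_funM (is_derive_cst c x 1) fa.
by rewrite mul0r add0r.
Qed.

Lemma is_derive_funX (n : nat) x : is_derive x 1 (fun y => y ^+ n) (n%:R * x ^+ n.-1).
Proof.
have := is_deriveX n (is_derive_id x 1).
by rewrite exprfctE /GRing.scale /= mulr1.
Qed.

Lemma is_derive_funsum (m n : nat) (f : nat -> R -> R) (df : nat -> R) x :
  (forall i, (m <= i < n)%N -> is_derive x 1 (f i) (df i)) ->
  is_derive x 1 (fun y => \sum_(m <= i < n) f i y) (\sum_(m <= i < n) df i).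
Proof.
elim: n => [|n IH] h.
  rewrite big_geq // (_ : (fun _ => _) = cst 0); first exact: is_derive_cst.
  by apply/funext => y; rewrite big_geq.
have [mn|nm] := leqP m n; last first.
  rewrite big_geq // (_ : (fun _ => _) = cst 0); first exact: is_derive_cst.
  by apply/funext => y; rewrite big_geq.
rewrite big_nat_recr //= (_ : (fun _ => _) = fun y => \sum_(m <= i < n) f i y + f n y).
  apply: is_derive_funD; last by apply: h; rewrite mn leqnn.
  by apply: IH => i /andP[mi im]; apply: h; rewrite mi ltnW.
by apply/funext => y; rewrite big_nat_recr.
Qed.

Lemma is_derive_funcomp f g x a b : is_derive x 1 g b -> is_derive (g x) 1 f a ->
  is_derive x 1 (fun y => f (g y)) (a * b).
Proof.
by move=> gb fa; have := is_derive1_comp fa gb; rewrite /GRing.scale /= mulrC.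
Qed.

Lemma is_derive_funV f x a : f x != 0 -> is_derive x 1 f a ->
  is_derive x 1 (fun y => (f y)^-1) (- a / f x ^+ 2).
Proof.
move=> fx0 fa; have := is_deriveV fx0 fa; rewrite /GRing.scale /=.
by congr (is_derive _ _ _ _); rewrite mulNr mulrC mulNr.
Qed.

Lemma within_funD (A : set R) f g : {within A, continuous f} ->
  {within A, continuous g} -> {within A, continuous (fun y => f y + g y)}.
Proof. by move=> cf cg x; exact: (continuousD (cf x) (cg x)). Qed.

Lemma within_funM (A : set R) f g : {within A, continuous f} ->
  {within A, continuous g} -> {within A, continuous (fun y => f y * g y)}.
Proof. by move=> cf cg x; exact: (continuousM (cf x) (cg x)). Qed.

Lemma within_cst (A : set R) c : {within A, continuous (fun _ : R => c)}.
Proof. by apply: continuous_subspaceT => x; exact: cst_continuous. Qed.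

Lemma within_funZ (A : set R) c f : {within A, continuous f} ->
  {within A, continuous (fun y => c * f y)}.
Proof. by apply: within_funM; exact: within_cst. Qed.

Lemma within_funB (A : set R) f g : {within A, continuous f} ->
  {within A, continuous g} -> {within A, continuous (fun y => f y - g y)}.
Proof. by move=> cf cg x; exact: (continuousB (cf x) (cg x)). Qed.

Lemma within_funX (A : set R) (n : nat) : {within A, continuous (fun y : R => y ^+ n)}.
Proof. by apply: continuous_subspaceT => x; exact: exprn_continuous. Qed.

Lemma within_funsum (A : set R) (m n : nat) (f : nat -> R -> R) :
  (forall i, (m <= i < n)%N -> {within A, continuous (f i)}) ->
  {within A, continuous (fun y => \sum_(m <= i < n) f i y)}.
Proof.
elim: n => [|n IH] h.
  rewrite (_ : (fun _ => _) = cst 0); first exact: within_cst.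
  by apply/funext => y; rewrite big_geq.
have [mn|nm] := leqP m n; last first.
  rewrite (_ : (fun _ => _) = cst 0); first exact: within_cst.
  by apply/funext => y; rewrite big_geq.
rewrite (_ : (fun _ => _) = fun y => \sum_(m <= i < n) f i y + f n y).
  apply: within_funD; last by apply: h; rewrite mn leqnn.
  by apply: IH => i /andP[mi im]; apply: h; rewrite mi ltnW.
by apply/funext => y; rewrite big_nat_recr.
Qed.

Lemma derivative_bound f (df : R -> R) c a b : a <= b ->
  {within `[a, b], continuous f} ->
  (forall x, a < x < b -> is_derive x 1 f (df x)) ->
  (forall x, a < x < b -> `|df x| <= c) -> `|f b - f a| <= c * (b - a).
Proof.
rewrite le_eqVlt => /predU1P[-> *|ab cf dff dfC]; first by rewrite !subrr normr0 mulr0.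
have [c' + ->] := MVT ab (fun x => dff x) cf; rewrite in_itv /= => cab.
by rewrite normrM (gtr0_norm (x := b - a)) ?subr_gt0 // ler_pM2r ?subr_gt0 // dfC.
Qed.

Lemma zero_derivative f (df : R -> R) a b : a <= b ->
  {within `[a, b], continuous f} ->
  (forall x, a < x < b -> is_derive x 1 f (df x)) ->
  (forall x, a < x < b -> df x = 0) -> f b = f a.
Proof.
move=> ab cf dff df0; apply/eqP; rewrite -subr_eq0 -normr_le0.
rewrite -(mul0r (b - a)); apply: (derivative_bound ab cf dff) => x /df0 ->.
by rewrite normr0.
Qed.

Lemma within_segmentS f a b a' b' : a <= a' -> b' <= b ->
  {within `[a, b], continuous f} -> {within `[a', b'], continuous f}.
Proof. by move=> aa' bb'; apply: continuous_subspaceW; apply: subset_itv; rewrite bnd_simp. Qed.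

Lemma within_segment_continuous f a b : a < b -> {within `[a, b], continuous f} ->
  forall x, a < x < b -> {for x, continuous f}.
Proof. by move=> ab /(continuous_within_itvP _ ab)[+ _ _] x xab; apply; rewrite in_itv. Qed.

(** For both signs [s], the mean value theorem shows that [c x^(n+1)/(n+1)! - s f] stays
    nonnegative, its derivative being so. Estimates in [u^n/n!] are propagated through primitives
    this way. *)
Lemma le_power_derivative f (df : R -> R) c b (n : nat) :
  {within `[0, b], continuous f} -> f 0 = 0 ->
  (forall x, 0 < x < b -> is_derive x 1 f (df x)) ->
  (forall x, 0 < x < b -> `|df x| <= c * x ^+ n / n`!%:R) ->
  forall x, 0 <= x <= b -> `|f x| <= c * x ^+ n.+1 / n.+1`!%:R.
Proof.
move=> cf f0 dff dfC x /andP[x0 xb].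
have sgn (s : R) : `|s| = 1 -> 0 <= c / n.+1`!%:R * x ^+ n.+1 - s * f x.
  move=> s1.
  pose g y := c / n.+1`!%:R * y ^+ n.+1 - s * f y.
  pose dg y := c / n.+1`!%:R * (n.+1%:R * y ^+ n) - s * df y.
  have dgg y : 0 < y < x -> is_derive y 1 g (dg y).
    move=> /andP[y0 yx]; apply: is_derive_funB; apply: is_derive_funZ.
      exact: is_derive_funX.
    by apply: dff; rewrite y0 (lt_le_trans yx).
  have cg : {within `[0, x], continuous g}.
    apply: within_funB; apply: within_funZ; first exact: within_funX.
    exact: within_segmentS cf.
  have g0 : g 0 = 0 by rewrite /g f0 expr0n /= !mulr0 subrr.
  move: x0; rewrite le_eqVlt => /predU1P[<-|x0]; first by rewrite -/(g 0) g0.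
  have [y + ] := MVT x0 (fun y => dgg y) cg; rewrite in_itv /= => /andP[y0 yx].
  rewrite g0 !subr0 -/(g x) => ->; rewrite mulr_ge0 ?(ltW x0) // subr_ge0.
  have -> : c / n.+1`!%:R * (n.+1%:R * y ^+ n) = c * y ^+ n / n`!%:R.
    rewrite factS natrM; field.
    by rewrite nat1r !pnatr_eq0 -!lt0n fact_gt0.
  rewrite (le_trans (ler_norm _)) // normrM s1 mul1r dfC // y0.
  exact: lt_le_trans xb.
have /= h1 := sgn 1 (normr1 _); have /= h2 := sgn (-1) (normrN1 _).
rewrite [leRHS]mulrAC ler_norml; apply/andP; split; lra.
Qed.

End Derivatives.

(** * Primitives vanishing at the origin *)

Section Primitives.
Context {R : realType}.
Implicit Types (f g : R -> R).

Definition primitive f (x : R) : R := (\int[lebesgue_measure]_(s in `[0, x]) f s)%R.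

Lemma primitive0 f : primitive f 0 = 0.
Proof. by rewrite /primitive set_itv1 Rintegral_set1. Qed.

Lemma integrable01 f : {within `[0, 1], continuous f} ->
  (@lebesgue_measure R).-integrable `[0, 1] (EFin \o f).
Proof. by move=> cf; apply: continuous_compact_integrable => //; exact: segment_compact. Qed.

Lemma continuous_primitive f : {within `[0, 1], continuous f} ->
  {within `[0, 1], continuous (primitive f)}.
Proof. by move=> /integrable01 If; exact: (parameterized_integral_continuous ler01 If). Qed.

Lemma is_derive_primitive f (x : R) : {within `[0, 1], continuous f} -> 0 < x < 1 ->
  is_derive x 1 (primitive f) (f x).
Proof.
move=> cf x01; have /andP[x0 x1] := x01.
have [df dE] := continuous_FTC1_closed x1 (integrable01 cf) x0
  (within_segment_continuous ltr01 cf x01).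
by split => //; rewrite -derive1E.
Qed.

End Primitives.

(** * The geometric functions and their iterated primitives *)

Section Geometric.
Context {R : realType}.
Implicit Types (u x : R) (m n : nat).

(** The geometric law of the level at time [u] when [d = 1] and time is scaled to [lambda = 1]. *)
Definition geom m u : R := u ^+ m / (1 + u) ^+ m.+1.

(* The jump rates of the level for [d = 1]; at [m = 0] the junk predecessor has
   weight [0]. *)
Definition gen (f : nat -> R) m : R :=
  m.+1%:R * (f m.+1 - f m) + m%:R * (f m.-1 - f m).

Lemma geom_at0 m : geom m 0 = (m == 0)%:R.
Proof. by rewrite /geom addr0 expr1n divr1 expr0n. Qed.

Lemma geom_gt0 m u : 0 < u -> 0 < geom m u.
Proof. by move=> u0; rewrite divr_gt0 // exprn_gt0 // addr_gt0. Qed.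

(** On [[0, 1]] the ratio [u / (1 + u)] is at most one half. This decay in [m] is what later kills
    the boundary term. *)
Lemma geom_le m u : 0 <= u <= 1 -> `|geom m u| <= 2^-1 ^+ m.
Proof.
move=> /andP[u0 u1]; have u1_gt0 : 0 < 1 + u by rewrite ltr_wpDr.
rewrite ger0_norm; last by rewrite divr_ge0 // exprn_ge0 // ltW.
rewrite /geom exprS invfM mulrCA -expr_div_n.
apply: (@le_trans _ _ ((u / (1 + u)) ^+ m)).
  by rewrite ler_piMl ?exprn_ge0 ?divr_ge0 ?invf_le1 ?lerDl // ltW.
by apply: lerXn2r; rewrite ?nnegrE ?divr_ge0 ?(ltW u1_gt0) ?invr_ge0 // ler_pdivrMr //; lra.
Qed.

(** The Kolmogorov equation for [d = 1]. The rates between neighbouring levels are symmetric, so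
    [gen] serves for both the forward and the backward equation. *)
Lemma is_derive_geom m u : 0 <= u -> is_derive u 1 (geom m) (gen (geom^~ u) m).
Proof.
move=> u0; have u1_neq0 : 1 + u != 0 by rewrite gt_eqF // ltr_wpDr.
have d1u : is_derive u 1 (fun y : R => 1 + y) 1.
  by have := is_derive_funD (is_derive_cst (1 : R) u 1) (is_derive_id u 1); rewrite add0r.
have dpow := is_derive_funcomp d1u (is_derive_funX m.+1 _).
have := is_derive_funM (is_derive_funX m u)
  (is_derive_funV (f := fun y => (1 + y) ^+ m.+1) (expf_neq0 _ u1_neq0) dpow).
congr (is_derive _ _ _ _); rewrite /gen /geom /=.
by case: m {dpow} => [|m] /=; rewrite ?expr0 ?exprS; field; rewrite ?expf_neq0 ?u1_neq0.
Qed.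

Lemma within_geom m : {within `[0, 1], continuous (geom m)}.
Proof.
apply: derivable_within_continuous => x; rewrite in_itv /= => /andP[x0 _].
by have [] := is_derive_geom m x0.
Qed.

Definition iprim n m : R -> R := iter n primitive (geom m).

Lemma within_iprim n m : {within `[0, 1], continuous (iprim n m)}.
Proof. by elim: n => [|n IH]; [exact: within_geom|exact: continuous_primitive]. Qed.

Lemma is_derive_iprim n m u : 0 < u < 1 -> is_derive u 1 (iprim n.+1 m) (iprim n m u).
Proof. exact/is_derive_primitive/within_iprim. Qed.

Lemma iprim_at0 n m : iprim n m 0 = ((n == 0) && (m == 0))%:R.
Proof. by case: n => [|n]; [exact: geom_at0|exact: primitive0]. Qed.

Lemma iprim_le n m u : 0 <= u <= 1 -> `|iprim n m u| <= 2^-1 ^+ m * u ^+ n / n`!%:R.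
Proof.
elim: n u => [|n IH] u u01; first by rewrite mulr1 divr1; exact: geom_le.
apply: le_power_derivative u01; first exact: within_iprim.
- exact: iprim_at0.
- by move=> x; exact: is_derive_iprim.
- by move=> x /andP[x0 x1]; apply: IH; rewrite !ltW.
Qed.

Lemma is_derive_gen (f df : nat -> R -> R) m u :
  (forall i, is_derive u 1 (f i) (df i u)) ->
  is_derive u 1 (fun y => gen (f^~ y) m) (gen (df^~ u) m).
Proof. by move=> h; apply: is_derive_funD; apply: is_derive_funZ; exact: is_derive_funB. Qed.

Lemma within_gen (f : nat -> R -> R) m (A : set R) :
  (forall i, {within A, continuous (f i)}) ->
  {within A, continuous (fun y => gen (f^~ y) m)}.
Proof. by move=> h; apply: within_funD; apply: within_funZ; exact: within_funB. Qed.

(** Induction on [n]: both sides have the same derivative and the same value at [0]. The extra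
    monomial is the repeated primitive of the constant [geom m 0], nonzero only at level [0]. *)
Lemma iprim_gen n m u : 0 <= u <= 1 ->
  iprim n m u = gen ((iprim n.+1)^~ u) m + (m == 0)%:R / n`!%:R * u ^+ n.
Proof.
elim: n u => [|n IH] u /andP[u0 u1].
  pose D y := gen ((iprim 1)^~ y) m + (m == 0)%:R - iprim 0 m y.
  have : D u = D 0.
    apply: (@zero_derivative _ _ (fun y => gen ((iprim 0)^~ y) m + 0 - gen (geom^~ y) m)) => //.
    - apply: within_segmentS (lexx _) u1 _; apply: within_funB; last exact: within_geom.
      by apply: within_funD; [apply: within_gen => i; exact: within_iprim|exact: within_cst].
    - move=> x /andP[x0 xu]; have x01 : 0 < x < 1 by rewrite x0 (lt_le_trans xu).
      apply: is_derive_funB; last by apply: is_derive_geom; rewrite ltW.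
      apply: is_derive_funD.
      by apply: (@is_derive_gen (iprim 1) (iprim 0)) => i; exact: is_derive_iprim.
    - by move=> x _; rewrite addr0 subrr.
  rewrite {2}/D /gen !iprim_at0 /= !subrr !mulr0 !add0r subrr /D => /eqP.
  by rewrite subr_eq0 divr1 mulr1 => /eqP ->.
pose D y := gen ((iprim n.+2)^~ y) m + (m == 0)%:R / n.+1`!%:R * y ^+ n.+1 - iprim n.+1 m y.
have : D u = D 0.
  apply: (@zero_derivative _ _ (fun y => gen ((iprim n.+1)^~ y) m +
    (m == 0)%:R / n.+1`!%:R * (n.+1%:R * y ^+ n) - iprim n m y)) => //.
  - apply: within_segmentS (lexx _) u1 _; apply: within_funB; last exact: within_iprim.
    apply: within_funD; first by apply: within_gen => i; exact: within_iprim.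
    by apply: within_funZ; exact: within_funX.
  - move=> x /andP[x0 xu]; have x01 : 0 < x < 1 by rewrite x0 (lt_le_trans xu).
    apply: is_derive_funB; last exact: is_derive_iprim.
    apply: is_derive_funD; last by apply: is_derive_funZ; exact: is_derive_funX.
    by apply: (@is_derive_gen (iprim n.+2) (iprim n.+1)) => i; exact: is_derive_iprim.
  - move=> x /andP[x0 xu]; rewrite IH; last by rewrite !ltW //= (lt_le_trans xu).
    rewrite factS natrM; field.
    by rewrite nat1r !pnatr_eq0 -!lt0n fact_gt0.
have -> : D 0 = 0 by rewrite /D /gen !iprim_at0 /= expr0n !subrr !mulr0 !add0r oppr0.
by move/eqP; rewrite subr_eq0 => /eqP.
Qed.

(** For [n = 0] this is the explicit remainder of the geometric series of [1/(1 + u)]; each further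
    primitive integrates both the polynomial and the bound. *)
Lemma iprim0_taylor n (J : nat) u : 0 <= u <= 1 ->
  `|iprim n 0 u - \sum_(0 <= j < J) (-1) ^+ j * j`!%:R / (n + j)`!%:R * u ^+ (n + j)|
  <= J`!%:R * u ^+ (n + J) / (n + J)`!%:R.
Proof.
have fact_neq0 k : k`!%:R != 0 :> R by rewrite pnatr_eq0 -lt0n fact_gt0.
elim: n u => [|n IH] u /andP[u0 u1].
  have u1_gt0 : 0 < 1 + u by rewrite ltr_wpDr.
  have -> : iprim 0 0 u - \sum_(0 <= j < J) (-1) ^+ j * j`!%:R / (0 + j)`!%:R * u ^+ (0 + j) =
      (-1) ^+ J * u ^+ J / (1 + u).
    elim: J => [|J IJ].
      by rewrite big_geq // subr0 /iprim /= /geom !expr0 expr1 mulr1.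
    rewrite big_nat_recr //= opprD addrA IJ add0n mulfK // !exprS; field.
    by rewrite gt_eqF.
  rewrite add0n [leRHS]mulrAC divff // mul1r !normrM normrX normrN1 expr1n mul1r.
  rewrite ger0_norm ?exprn_ge0 // ler_piMr ?exprn_ge0 //.
  by rewrite gtr0_norm ?invr_gt0 // invf_le1 // lerDl.
rewrite addSn; apply: (@le_power_derivative _
  (fun y => iprim n.+1 0 y - \sum_(0 <= j < J) (-1) ^+ j * j`!%:R /
    (n.+1 + j)`!%:R * y ^+ (n.+1 + j))
  (fun y => iprim n 0 y - \sum_(0 <= j < J) (-1) ^+ j * j`!%:R /
    (n.+1 + j)`!%:R * ((n + j).+1%:R * y ^+ (n + j))) _ 1).
- apply: within_funB; first exact: within_iprim.
  by apply: within_funsum => i _; apply: within_funZ; exact: within_funX.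
- rewrite iprim_at0 big1 ?subrr // => i _.
  by rewrite addSn expr0n mulr0.
- move=> x x01; apply: is_derive_funB; first exact: is_derive_iprim.
  by apply: is_derive_funsum => i _; apply: is_derive_funZ; exact: is_derive_funX.
- move=> x /andP[x0 x1].
  rewrite (eq_bigr (fun j => (-1) ^+ j * j`!%:R / (n + j)`!%:R * x ^+ (n + j))).
    by apply: IH; rewrite !ltW.
  move=> j _; rewrite addSn factS natrM; field.
  by rewrite fact_neq0 -natrD nat1r pnatr_eq0.
- by rewrite u0.
Qed.

(** The function expanded is [-1/(1 + u)^2], whose Taylor remainder has a closed form, found by
    induction on [J]. *)
Lemma geom0_derive_taylor (J : nat) u : 0 <= u <= 1 ->
  `|gen (geom^~ u) 0 - \sum_(0 <= j < J) (-1) ^+ j.+1 * j.+1%:R * u ^+ j|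
  <= J.+1%:R * u ^+ J.
Proof.
move=> /andP[u0 u1]; have u1_gt0 : 0 < 1 + u by rewrite ltr_wpDr.
have -> : gen (geom^~ u) 0 - \sum_(0 <= j < J) (-1) ^+ j.+1 * j.+1%:R * u ^+ j =
    (-1) ^+ J.+1 * (u ^+ J * ((J.+1%:R + J%:R * u) / (1 + u) ^+ 2)).
  elim: J => [|J IJ].
    rewrite big_geq // subr0 /gen /geom /=; field.
    by rewrite gt_eqF.
  rewrite big_nat_recr //= opprD addrA IJ !exprS -!natr1; field.
  by rewrite gt_eqF.
rewrite normrM normrX normrN1 expr1n mul1r normrM ger0_norm ?exprn_ge0 // mulrC.
rewrite ler_wpM2r ?exprn_ge0 // ger0_norm.
  rewrite ler_pdivrMr ?exprn_gt0 // -natr1.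
  have := ler0n R J; nra.
by rewrite divr_ge0 ?exprn_ge0 ?(ltW u1_gt0) // addr_ge0 // mulr_ge0.
Qed.

End Geometric.

(** * Approximate solutions and the pairing argument *)

Section Pairing.
Context {R : realType}.
Implicit Types (u x s : R) (m n : nat).

Lemma within_comp (A B : set R) (f g : R -> R) : continuous g ->
  (forall x, A x -> B (g x)) -> {within B, continuous f} ->
  {within A, continuous (fun x => f (g x))}.
Proof.
move=> cg gAB /subspace_continuousP cf; apply/subspace_continuousP => x Ax U fU.
have h : nbhs x [set y | B (g y) -> U (f (g y))] := cg x _ (cf (g x) (gAB x Ax) U fU).
by apply: filterS h => y h Ay; exact: h (gAB y Ay).
Qed.

(** A discrete Green identity: [gen] is symmetric, so everything telescopes except the flux through
    the last level. *)
Lemma sum_gen_by_parts (f g : nat -> R) (M : nat) :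
  \sum_(0 <= m < M) (gen f m * g m - f m * gen g m) =
  M%:R * (f M * g M.-1 - f M.-1 * g M).
Proof.
elim: M => [|M IH]; first by rewrite big_geq // mul0r.
by rewrite big_nat_recr //= IH /gen; ring.
Qed.

Lemma gen_sum (f : nat -> R) (g : nat -> nat -> R) (b : nat -> R) c m p q :
  gen (fun i => f i + c * \sum_(p <= n < q) b n * g n i) m =
  gen f m + c * \sum_(p <= n < q) b n * gen (g n) m.
Proof.
rewrite /gen.
rewrite [in RHS](eq_bigr (fun n => m.+1%:R * (b n * g n m.+1) +
  (- (m.+1%:R + m%:R) * (b n * g n m) + m%:R * (b n * g n m.-1)))); last first.
  by move=> n _; ring.
by rewrite !big_split /= -!mulr_sumr; ring.
Qed.

Variables (a : nat -> R) (d : R).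
Hypothesis d_ge1 : 1 <= d.
Hypothesis a_ge0 : forall n, 0 <= a n.
Hypothesis a_rec : forall n, (0 < n)%N ->
  a n = d * n`!%:R + (d - 1) * \sum_(1 <= b < n) a b * (n - b)`!%:R.

Let c := (d - 1) / d.
Let d_neq0 : d != 0. Proof. by rewrite gt_eqF // (lt_le_trans ltr01). Qed.
Let c_ge0 : 0 <= c.
Proof. by rewrite divr_ge0 ?subr_ge0 // (le_trans ler01). Qed.

(** The series [W_m] truncated at [n = K]. For [m > 0] it approximates the probability of a single
    state of level [m], not of all [d] of them. *)
Definition level_approx (K m : nat) u : R :=
  geom m u + c * \sum_(1 <= n < K.+1) ((-1) ^+ n * a n) * iprim n m u.

Definition level_approx_deriv (K m : nat) u : R :=
  gen (geom^~ u) m + c * \sum_(1 <= n < K.+1) ((-1) ^+ n * a n) * iprim n.-1 m u.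

(* Truncated derivative of [sum_n a_n (-u)^n / n!], the probability of being at
   the origin. *)
Definition origin_deriv (K : nat) u : R :=
  \sum_(1 <= n < K.+1) ((-1) ^+ n * a n) * (u ^+ n.-1 / (n.-1)`!%:R).

Lemma is_derive_level_approx K m u : 0 < u < 1 ->
  is_derive u 1 (level_approx K m) (level_approx_deriv K m u).
Proof.
move=> u01; apply: is_derive_funD.
  by apply: is_derive_geom; case/andP: u01 => /ltW.
apply: is_derive_funZ; apply: is_derive_funsum => -[|n] //= _.
by apply: is_derive_funZ; exact: is_derive_iprim.
Qed.

Lemma within_level_approx K m : {within `[0, 1], continuous (level_approx K m)}.
Proof.
apply: within_funD; first exact: within_geom.
apply: within_funZ; apply: within_funsum => n _.
by apply: within_funZ; exact: within_iprim.
Qed.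

(** The monomials produced by [iprim_gen] all sit at level [0], where they add up to a multiple of
    [origin_deriv]. *)
Lemma level_approx_derivE K m u : 0 <= u <= 1 ->
  level_approx_deriv K m u = gen ((level_approx K)^~ u) m + (m == 0)%:R * (c * origin_deriv K u).
Proof.
move=> u01; rewrite /level_approx (gen_sum (geom^~ u) (fun n i => iprim n i u)).
rewrite -addrA; congr (_ + _); rewrite mulrCA -mulrDr; congr (c * _).
rewrite mulr_sumr -big_split /= !big_add1 /=; apply: eq_bigr => n _.
rewrite (iprim_gen n m u01); ring.
Qed.

Lemma level_approx_at0 K m : level_approx K m 0 = (m == 0)%:R.
Proof.
rewrite /level_approx geom_at0 big_add1 big1 ?mulr0 ?addr0 // => n _.
by rewrite iprim_at0 mulr0.
Qed.

Lemma level_approx_le K m u : 0 <= u <= 1 ->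
  `|level_approx K m u| <= (1 + c * \sum_(1 <= n < K.+1) a n) * 2^-1 ^+ m.
Proof.
move=> u01; rewrite mulrDl mul1r (le_trans (ler_normD _ _)) // lerD ?geom_le //.
rewrite normrM (ger0_norm c_ge0) -mulrA ler_wpM2l // (le_trans (ler_norm_sum _ _ _)) //.
rewrite mulr_suml; apply: ler_sum => n _.
rewrite !normrM normrX normrN1 expr1n mul1r (ger0_norm (a_ge0 n)) ler_wpM2l //.
apply: (le_trans (iprim_le _ _ u01)); rewrite -mulrA ler_piMr ?exprn_ge0 //.
case/andP: u01 => u0 u1; rewrite mulr_ile1 ?exprn_ge0 ?exprn_ile1 ?invr_ge0 //.
by rewrite invf_le1 ?ler1n ?ltr0n ?fact_gt0.
Qed.

(** The recurrence makes all coefficients of degree below [K] on the two sides agree, so only Taylor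
    remainders are left; the recurrence at [K + 1] sums their bounds. *)
Lemma origin_deriv_sub K u : 0 <= u <= 1 ->
  `|origin_deriv K u - level_approx_deriv K 0 u| <= a K.+1 * u ^+ K / K`!%:R.
Proof.
move=> u01; have [u0 u1] := andP u01.
have fact_neq0 k : k`!%:R != 0 :> R by rewrite pnatr_eq0 -lt0n fact_gt0.
(* [P i] and [Q] are the Taylor polynomials, of degree below [K], of [iprim i 0] and of the
   derivative of [geom 0]. *)
pose P i := \sum_(0 <= j < K - i) (-1) ^+ j * j`!%:R / (i + j)`!%:R * u ^+ (i + j).
pose Q := \sum_(0 <= j < K) (-1) ^+ j.+1 * j.+1%:R * u ^+ j.
(* The recurrence divided by [d]; the term [i = n] of the sum is [a n.+1] itself, which accounts for
   [1 - c = 1/d]. *)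
have aS n : a n.+1 = n.+1`!%:R + c * \sum_(0 <= i < n.+1) a i.+1 * (n - i)`!%:R.
  have dc : d * c = d - 1 by rewrite /c mulrC divfK.
  apply: (mulfI d_neq0); rewrite mulrDr mulrA dc.
  rewrite big_nat_recr //= subnn fact0 mulr1 {1 2}a_rec // big_add1 /=.
  under [X in _ = _ + _ * (X + _)]eq_bigr => i _ do rewrite -subSS.
  ring.
have polyE : origin_deriv K u - (Q + c * \sum_(0 <= i < K) (-1) ^+ i.+1 * a i.+1 * P i) = 0.
  have -> : \sum_(0 <= i < K) (-1) ^+ i.+1 * a i.+1 * P i =
      \sum_(0 <= n < K) (-1) ^+ n.+1 * u ^+ n / n`!%:R * \sum_(0 <= i < n.+1) a i.+1 * (n - i)`!%:R.
    transitivity (\sum_(0 <= i < K) \sum_(i <= n < K)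
       (-1) ^+ n.+1 * u ^+ n / n`!%:R * (a i.+1 * (n - i)`!%:R)).
      apply: eq_bigr => i _; rewrite /P mulr_sumr -[i in index_iota i K]add0n big_addn; apply: eq_bigr => j _.
      by rewrite addnK (addnC j) !exprS !exprD; ring.
    under eq_bigr => i _ do rewrite (big_nat_widenl _ 0) //.
    rewrite (exchange_big_dep_nat predT) //=; apply: eq_big_nat => n /andP[_ nK].
    by rewrite mulr_sumr (big_nat_widen _ n.+1 K).
  rewrite /origin_deriv big_add1 /= /Q mulr_sumr -big_split -sumrB big1 //= => n _.
  rewrite aS factS natrM; field.
  by rewrite fact_neq0.
have -> : origin_deriv K u - level_approx_deriv K 0 u =
    - ((gen (geom^~ u) 0 - Q) + c * \sum_(0 <= i < K) (-1) ^+ i.+1 * a i.+1 * (iprim i 0 u - P i)).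
  apply/eqP; rewrite -subr_eq0; apply/eqP; rewrite -[RHS]polyE /level_approx_deriv big_add1 /=.
  under [X in _ - - (_ + c * X)]eq_bigr => i _ do rewrite mulrBr.
  by rewrite sumrB; ring.
rewrite normrN (le_trans (ler_normD _ _)) //.
(* Each summand bounds one remainder, except [i = K], which is nonnegative and dropped. *)
have -> : a K.+1 * u ^+ K / K`!%:R = K.+1%:R * u ^+ K +
    c * \sum_(0 <= i < K.+1) a i.+1 * ((K - i)`!%:R * u ^+ K / K`!%:R).
  rewrite aS !mulrDl factS natrM -[c * _ * _ * _]mulrA -[c * _ * _]mulrA mulr_suml.
  congr (_ + c * _); first by field; rewrite fact_neq0.
  by apply: eq_bigr => i _; rewrite !mulrA.
apply: lerD; first exact: geom0_derive_taylor.
rewrite normrM (ger0_norm c_ge0) ler_wpM2l // big_nat_recr //= ler_wpDr //.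
  by rewrite mulr_ge0 // mulr_ge0 ?invr_ge0 // mulr_ge0 ?exprn_ge0.
rewrite (le_trans (ler_norm_sum _ _ _)) // !big_nat; apply: ler_sum => i /andP[_ iK].
rewrite !normrM normrX normrN1 expr1n mul1r (ger0_norm (a_ge0 _)) ler_wpM2l //.
by have := iprim0_taylor i (K - i) u01; rewrite subnKC // ltnW.
Qed.

End Pairing.

(** * Comparison of a solution of the backward equation with the truncated series *)

Section PairingBound.
Context {R : realType}.
Variables (a : nat -> R) (d : R).
Hypothesis d_ge1 : 1 <= d.
Hypothesis a_ge0 : forall n, 0 <= a n.
Hypothesis a_rec : forall n, (0 < n)%N ->
  a n = d * n`!%:R + (d - 1) * \sum_(1 <= b < n) a b * (n - b)`!%:R.

Variables (F : nat -> R -> R) (x B : R) (k : nat).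
Hypothesis x01 : 0 < x < 1.
Hypothesis cF : forall m, {within `[0, x], continuous (F m)}.
Hypothesis dF : forall m u, 0 < u < x -> is_derive u 1 (F m)
  (gen (F^~ u) m + (d - 1) * ((m == 1)%:R - (m == 0)%:R) * F 0%N u).
Hypothesis F_le : forall m u, 0 <= u <= x -> `|F m u| <= B.
Hypothesis F_at0 : forall m, F m 0 = (m == k)%:R.

Lemma pairing_truncated (K M : nat) : (k < M.+2)%N ->
  `|F 0%N x - level_approx a d K k x| <=
  (M.+2%:R * (B * (2 * (1 + (d - 1) / d * \sum_(1 <= n < K.+1) a n) * 2^-1 ^+ M.+1))
   + B * ((d - 1) * (a K.+1 * x ^+ K / K`!%:R))) * x.
Proof.
move=> kM; have [x0 x1] := andP x01.
set E := a K.+1 * x ^+ K / K`!%:R; set A := 1 + _.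
pose W := level_approx a d K; pose dW := level_approx_deriv a d K.
pose G u m := gen (F^~ u) m + (d - 1) * ((m == 1)%:R - (m == 0)%:R) * F 0%N u.
pose Phi s := \sum_(0 <= m < M.+2) F m s * W m (x - s).
pose dPhi s := \sum_(0 <= m < M.+2) (G s m * W m (x - s) + F m s * (dW m (x - s) * -1)).
(* The endpoints: [W] at time [0] is concentrated on level [0], and [F] at time [0] on level [k],
   which is in the range of the sum by [k < M.+2]. *)
have <- : Phi x = F 0%N x.
  rewrite /Phi subrr big_ltn // big_nat_cond big1; last first.
    by move=> [|m] // _; rewrite /W level_approx_at0 mulr0.
  by rewrite /W level_approx_at0 eqxx mulr1 addr0.
have <- : Phi 0 = level_approx a d K k x.
  rewrite /Phi subr0 (bigD1_seq k) ?mem_index_iota ?iota_uniq //= F_at0 eqxx mul1r.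
  by rewrite big1 ?addr0 // => m /negPf mk; rewrite F_at0 mk mul0r.
rewrite -[leRHS]mulr1 -[x in leRHS]subr0 mulr1.
have xs01 s : 0 <= s <= x -> 0 <= x - s <= 1.
  by move=> /andP[s0 sx]; rewrite subr_ge0 sx lerBlDr (le_trans (ltW x1)) // lerDl.
apply: (@derivative_bound _ _ dPhi) => [|||s /andP[s0 sx]].
- exact: ltW.
- apply: within_funsum => m _; apply: within_funM => //.
  apply: (@within_comp _ _ `[0, 1] (W m) (fun s => x - s)); last exact: within_level_approx.
    by move=> s; apply: continuousB => //; exact: cst_continuous.
  by move=> s /=; rewrite !in_itv /=; exact: xs01.
- move=> s /andP[s0 sx]; apply: is_derive_funsum => m _; apply: is_derive_funM.
    by apply: dF; rewrite s0.
  apply: is_derive_funcomp; last first.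
    apply: is_derive_level_approx; rewrite subr_gt0 sx /=.
    by rewrite ltrBlDr (lt_trans x1) // ltrDl.
  by have := is_derive_funB (is_derive_funcst x s) (is_derive_id s 1); rewrite sub0r.
have s0x : 0 <= s <= x by rewrite !ltW.
have u01 := xs01 _ s0x; set u := x - s in u01 *.
have WE m : dW m u = gen (W^~ u) m + (m == 0)%:R * ((d - 1) / d * origin_deriv a K u).
  exact: level_approx_derivE.
have d_neq0 : d != 0 by rewrite gt_eqF // (lt_le_trans ltr01).
(* The extra terms of [dF] at levels [0] and [1] give [(d - 1) F_0 (W_1 - W_0)], and [W_1 - W_0] is
   [dW 0] minus [(d - 1)/d] times [origin_deriv]. With the inhomogeneous term of [dW 0] this
   collects into the defect bounded by [origin_deriv_sub]. *)
have -> : dPhi s = M.+2%:R * (F M.+2 s * W M.+1 u - F M.+1 s * W M.+2 u)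
    - F 0%N s * ((d - 1) * (origin_deriv a K u - dW 0%N u)).
  have := sum_gen_by_parts (F^~ s) (W^~ u) M.+2 => /= <-.
  rewrite /dPhi [in LHS]big_nat_recl // [in LHS]big_nat_recl //.
  rewrite [in RHS]big_nat_recl // [in RHS]big_nat_recl //= /G !WE /=.
  rewrite (eq_bigr (fun m => gen (F^~ s) m.+2 * W m.+2 u - F m.+2 s * gen (W^~ u) m.+2)).
    by rewrite [gen (W^~ u) 0]/gen /= mul0r; field.
  by move=> m _; rewrite !WE /=; ring.
have FB m : `|F m s| <= B by exact: F_le.
have B0 : 0 <= B by exact: le_trans (FB 0%N).
rewrite (le_trans (ler_normB _ _)) //; apply: lerD.
  rewrite normrM ger0_norm ?ler0n // ler_wpM2l //.
  have WA m : `|W m u| <= A * 2^-1 ^+ m by exact: level_approx_le.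
  have A0 : 0 <= A by have := WA 0%N; rewrite mulr1; exact: le_trans.
  rewrite (le_trans (ler_normB _ _)) // !normrM.
  apply: (@le_trans _ _ (B * (A * 2^-1 ^+ M.+1) + B * (A * 2^-1 ^+ M.+1))).
    apply: lerD; apply: ler_pM => //; apply: (le_trans (WA _)).
    by rewrite ler_wpM2l // exprS ler_piMl ?exprn_ge0 ?invr_ge0 // invf_le1 ?ltr0n // ler1n.
  by rewrite le_eqVlt; apply/orP; left; apply/eqP; ring.
rewrite normrM ler_pM // normrM ger0_norm ?subr_ge0 // ler_wpM2l ?subr_ge0 //.
apply: (le_trans (origin_deriv_sub _ _ _ _ _)) => //.
rewrite /E -!mulrA ler_wpM2l // ler_pM2r ?invr_gt0 ?ltr0n ?fact_gt0 //.
by rewrite lerXn2r ?nnegrE ?(ltW x0) ?(andP u01).1 // /u gerBl ltW.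
Qed.

Lemma pairing (K : nat) :
  `|F 0%N x - level_approx a d K k x| <= B * ((d - 1) * (a K.+1 * x ^+ K / K`!%:R)) * x.
Proof.
set D := 2 * (1 + (d - 1) / d * \sum_(1 <= n < K.+1) a n).
set E := B * _.
have half : 0 <= (2^-1 : R) < 1 by rewrite invr_ge0 ler0n invf_lt1 // ltr1n.
(* Writing [M + 2] as ['C(M.+2, 1)] makes [cvg_bin_exp] give the limit of [(M + 2) / 2^(M+2)]; the
   factor [2] compensates for the exponent [M + 1] in the bound. *)
have cv : (fun M => 'C(M.+2, 1)%:R * 2^-1 ^+ M.+2 * (2 * B * D * x) + E * x) @ \oo --> E * x.
  rewrite -[X in _ --> X]add0r -[in X in _ --> X](mul0r (2 * B * D * x)).
  apply: cvgD; last exact: cvg_cst.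
  apply: cvgMl; have := cvg_bin_exp 1 half.
  by rewrite -(cvg_shiftn 2); under eq_fun do rewrite addn2.
rewrite -(cvg_lim (@Rhausdorff _) cv); apply: limr_ge.
  by apply/cvg_ex; exists (E * x).
exists k => // M /= kM; have := @pairing_truncated K M (leq_trans kM (leqnSn _)).
move/le_trans; apply; rewrite mulrDl lerD2r bin1 -/D !exprS.
by rewrite le_eqVlt; apply/orP; left; apply/eqP; field.
Qed.

End PairingBound.

(** * The inner series *)

Section InnerSeries.
Context {R : realType}.
Implicit Types (x s w z : R) (m n k r : nat).

Lemma pochhammerS (b : R) n : pochhammer b n.+1 = pochhammer b n * (b + n%:R).
Proof. by rewrite /pochhammer big_ord_recr. Qed.

Lemma pochhammer0 (b : R) : pochhammer b 0 = 1.
Proof. by rewrite /pochhammer big_ord0. Qed.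

Lemma pochhammer_ratio n r : (0 < n)%N ->
  pochhammer n%:R r / pochhammer n.+1%:R r = n%:R / (n + r)%:R :> R.
Proof.
move=> n0; have nr0 i : (n + i)%:R != 0 :> R by rewrite pnatr_eq0 addn_eq0; case: n n0.
elim: r => [|r IH]; first by rewrite !pochhammer0 addn0 !divff // ?oner_eq0 // -(addn0 n) nr0.
rewrite !pochhammerS -natrD -natrD invfM mulrACA IH mulrA addSnnS addnS.
by field; rewrite -?natrD ?nat1r -?addnS !nr0.
Qed.

Lemma pochhammer_opp n r : pochhammer (- r%:R : R) n = (-1) ^+ n * (r ^_ n)%:R.
Proof.
elim: n => [|n IH]; first by rewrite pochhammer0 mul1r.
rewrite pochhammerS IH exprS ffactnSr natrM; have [nr|rn] := leqP n r.
  by rewrite natrB //; ring.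
by rewrite ffact_small // !(mul0r, mulr0).
Qed.

Lemma pochhammer1 n : pochhammer (1 : R) n = n`!%:R.
Proof.
elim: n => [|n IH]; first by rewrite pochhammer0.
by rewrite pochhammerS IH factS natrM nat1r mulrC.
Qed.

(** The signs of the two Pochhammer symbols cancel, each symbol is a falling factorial, and the
    parameter [-k] ends the sum at [i = k]. *)
Lemma hypergeometric_opp_opp r k (y : R) :
  hypergeometric2F1 (- r%:R) (- k%:R) 1 y =
  \sum_(0 <= i < k.+1) 'C(k, i)%:R * 'C(r, i)%:R * y ^+ i.
Proof.
have tE i : pochhammer (- r%:R) i * pochhammer (- k%:R) i / pochhammer 1 i *
    (y ^+ i / i`!%:R) = 'C(k, i)%:R * 'C(r, i)%:R * y ^+ i.
  rewrite !pochhammer_opp pochhammer1 -!bin_ffact !natrM.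
  have -> : (-1) ^+ i * ('C(r, i)%:R * i`!%:R) * ((-1) ^+ i * ('C(k, i)%:R * i`!%:R)) =
      'C(r, i)%:R * i`!%:R * ('C(k, i)%:R * i`!%:R) :> R.
    by rewrite mulrACA -expr2 -exprM mulnC exprM sqrrN expr1n expr1n mul1r.
  by field; rewrite pnatr_eq0 -lt0n fact_gt0.
rewrite /hypergeometric2F1; apply: cvg_lim => //.
apply: cvg_near_cst; exists k.+1 => // N /= kN.
rewrite (eq_bigr _ (fun i _ => tE i)) (big_cat_nat (n := k.+1)) //=.
rewrite [X in _ + X]big_nat_cond [X in _ + X]big1 ?addr0 // => i /andP[/andP[ki _] _].
by rewrite bin_small // !mul0r.
Qed.

Definition bin_sum w i : R := w ^+ i / (1 - w) ^+ i.+1.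
Definition bin_part w i : nat -> R := series (fun r => 'C(r, i)%:R * w ^+ r).

(** The tail is a power series with nonnegative coefficients, hence increasing in [w]; one value [z]
    controls all smaller ones uniformly. *)
Lemma bin_tail_le w z i (N : nat) : 0 <= w <= z -> z < 1 ->
  `|bin_sum w i - bin_part w i N| <= bin_sum z i - bin_part z i N.
Proof.
move=> /andP[w0 wz] z1; have z0 := le_trans w0 wz; have w1 := le_lt_trans wz z1.
have cw : bin_part w i @ \oo --> bin_sum w i by apply: cvg_series_bin; rewrite w0.
have cz : bin_part z i @ \oo --> bin_sum z i by apply: cvg_series_bin; rewrite z0.
have czw : (fun n => bin_part z i n - bin_part w i n) @ \oo --> bin_sum z i - bin_sum w i.
  exact: cvgB.
rewrite ger0_norm.
  suff : bin_part z i N - bin_part w i N <= bin_sum z i - bin_sum w i by lra.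
  rewrite -(cvg_lim (@Rhausdorff _) czw).
  apply: (@nondecreasing_cvgn_le _ (fun n => bin_part z i n - bin_part w i n)).
    apply/nondecreasing_seqP => n.
    rewrite /bin_part !seriesSr -addrA lerD2l opprD addrCA lerDl subr_ge0.
    by rewrite ler_wpM2l // lerXn2r.
  by apply/cvg_ex; eexists; exact: czw.
rewrite subr_ge0 -(cvg_lim (@Rhausdorff _) cw); apply: nondecreasing_cvgn_le.
  by apply: nondecreasing_series => n _ _; rewrite mulr_ge0 ?exprn_ge0.
by apply/cvg_ex; eexists; exact: cw.
Qed.

(** With [w = (x - s)/(1 + x)] one has [w/(1 - w) = (x - s)/(1 + s)], so the sum is the binomial
    expansion of the [k]-th power of [1 - (x - s)/(x (1 + s)) = s (1 + x)/(x (1 + s))]. *)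
Lemma geom_expansion k x s : 0 < x -> 0 <= s ->
  geom k s = geom k x *
    \sum_(0 <= i < k.+1) 'C(k, i)%:R * (- (1 / x)) ^+ i * bin_sum ((x - s) / (1 + x)) i.
Proof.
move=> x0 s0; have x1 : 1 + x != 0 by rewrite gt_eqF // addr_gt0.
have s1 : 1 + s != 0 by rewrite gt_eqF // ltr_wpDr.
have xn0 : x != 0 by rewrite gt_eqF.
have wE : 1 - (x - s) / (1 + x) = (1 + s) / (1 + x) by field.
have := exprDn 1 (- (x - s) / (x * (1 + s))) k.
have -> : 1 + - (x - s) / (x * (1 + s)) = s * (1 + x) / (x * (1 + s)).
  by field; rewrite s1.
rewrite -(big_mkord xpredT (fun i => 1 ^+ (k - i) * (- (x - s) / (x * (1 + s))) ^+ i *+ 'C(k, i))).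
move=> bE.
have -> : \sum_(0 <= i < k.+1) 'C(k, i)%:R * (- (1 / x)) ^+ i * bin_sum ((x - s) / (1 + x)) i =
    (1 + x) / (1 + s) * (s * (1 + x) / (x * (1 + s))) ^+ k.
  rewrite bE mulr_sumr; apply: eq_bigr => i _.
  have -> : - (x - s) / (x * (1 + s)) = - (1 / x) * ((x - s) / (1 + x)) * ((1 + x) / (1 + s)).
    by field; rewrite s1 x1.
  have -> : (1 + x) / (1 + s) = (1 - (x - s) / (1 + x))^-1 by rewrite wE invf_div.
  have q0 : 1 - (x - s) / (1 + x) != 0 by rewrite wE mulf_neq0 ?invr_neq0.
  rewrite /bin_sum expr1n -(mulr_natl (1 * _)); move: q0.
  move: (- (1 / x)) ((x - s) / (1 + x)) => y w; move: (1 - w) => q q0.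
  rewrite !exprMn exprVn exprS.
  by field; rewrite q0 expf_neq0.
rewrite /geom !expr_div_n !exprMn !exprS; field.
by rewrite ?expf_neq0 ?mulf_neq0 ?expf_neq0 ?s1 ?x1 ?xn0.
Qed.

(* The hypergeometric factor of the inner series, a Meixner polynomial in [k]. *)
Definition meixner x k r : R :=
  \sum_(0 <= i < k.+1) 'C(k, i)%:R * 'C(r, i)%:R * (- (1 / x)) ^+ i.

(** The remainder at [s = 0], where [(x - s)/(1 + x)] is largest, with the signs removed: a bound
    uniform in [s]. *)
Definition inner_error x k (N : nat) : R :=
  \sum_(0 <= i < k.+1) 'C(k, i)%:R * (1 / x) ^+ i *
    (bin_sum (x / (1 + x)) i - bin_part (x / (1 + x)) i N).

Lemma geom_partial k x s (N : nat) : 0 < x -> 0 <= s <= x ->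
  `|geom k s - geom k x * \sum_(0 <= r < N) ((x - s) / (1 + x)) ^+ r * meixner x k r|
  <= geom k x * inner_error x k N.
Proof.
move=> x0 /andP[s0 sx]; have x1 : 0 < 1 + x by rewrite addr_gt0.
rewrite (geom_expansion k x0 s0) -mulrBr normrM gtr0_norm ?geom_gt0 // ler_pM2l ?geom_gt0 //.
have -> : \sum_(0 <= r < N) ((x - s) / (1 + x)) ^+ r * meixner x k r =
    \sum_(0 <= i < k.+1) 'C(k, i)%:R * (- (1 / x)) ^+ i * bin_part ((x - s) / (1 + x)) i N.
  rewrite /bin_part /series /=; under [RHS]eq_bigr do rewrite mulr_sumr.
  rewrite exchange_big /=; apply: eq_bigr => r _; rewrite /meixner mulr_sumr.
  by apply: eq_bigr => i _; ring.
rewrite -sumrB (le_trans (ler_norm_sum _ _ _)) //; apply: ler_sum => i _.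
rewrite -mulrBr normrM normrM normrX normrN (ger0_norm (x := _%:R)) //.
rewrite (ger0_norm (x := 1 / x)) ?divr_ge0 ?(ltW x0) //.
rewrite ler_wpM2l //; first by rewrite mulr_ge0 // exprn_ge0 // divr_ge0 // ltW.
apply: bin_tail_le.
  rewrite divr_ge0 ?subr_ge0 ?(ltW x1) //= ler_pM2r ?invr_gt0 //.
  by rewrite gerBl.
by rewrite ltr_pdivrMr // mul1r ltrDr.
Qed.

Lemma cvg_inner_error k x : 0 < x -> inner_error x k @ \oo --> (0 : R).
Proof.
move=> x0; have x1 : 0 < 1 + x by rewrite addr_gt0.
have cvs : (fun N => \sum_(0 <= i < k.+1) 'C(k, i)%:R * (1 / x) ^+ i *
    (bin_sum (x / (1 + x)) i - bin_part (x / (1 + x)) i N)) @ \oo -->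
    \sum_(0 <= i < k.+1) 'C(k, i)%:R * (1 / x) ^+ i *
    (bin_sum (x / (1 + x)) i - bin_sum (x / (1 + x)) i).
  apply: cvg_big => [|i _]; first exact: add_continuous.
  apply: cvgMr; apply: cvgB; first exact: cvg_cst.
  apply: cvg_series_bin; rewrite divr_ge0 ?(ltW x0) ?(ltW x1) //=.
  by rewrite ltr_pdivrMr // mul1r ltrDr.
by rewrite big1 in cvs => // i _; rewrite subrr mulr0.
Qed.

(* Iterated integration by parts of [s |-> (x - s)^p / p! * iprim m k s]. *)
Fixpoint parts_primitive x k (p m : nat) s : R :=
  if p is p'.+1 then iprim m.+1 k s * ((x - s) ^+ p / p`!%:R) + parts_primitive x k p' m.+1 s
  else iprim m.+1 k s.

Lemma is_derive_subX x s n : is_derive s 1 (fun s => (x - s) ^+ n) (- n%:R * (x - s) ^+ n.-1).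
Proof.
have := is_derive_funB (is_derive_funcst x s) (is_derive_id s 1).
move=> /is_derive_funcomp - /(_ _ _ (is_derive_funX n _)).
by congr (is_derive _ _ _ _); rewrite sub0r; ring.
Qed.

Lemma is_derive_parts x k p m s : 0 < s < 1 ->
  is_derive s 1 (parts_primitive x k p m) ((x - s) ^+ p / p`!%:R * iprim m k s).
Proof.
move=> s01; elim: p m => [|p IH] m /=; first by rewrite divr1 mul1r; exact: is_derive_iprim.
have dX : is_derive s 1 (fun s => (x - s) ^+ p.+1 / p.+1`!%:R) (- ((x - s) ^+ p / p`!%:R)).
  have := is_derive_funM (is_derive_subX x s p.+1) (is_derive_funcst (p.+1`!%:R^-1) s).
  congr (is_derive _ _ _ _); rewrite factS natrM /=; field.
  by rewrite nat1r !pnatr_eq0 -lt0n fact_gt0.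
have := is_derive_funD (is_derive_funM (is_derive_iprim m k s01) dX) (IH m.+1).
by congr (is_derive _ _ _ _); ring.
Qed.

Lemma within_subX (A : set R) x n : {within A, continuous (fun s => (x - s) ^+ n)}.
Proof.
apply: (@within_comp _ A setT (fun s => s ^+ n) (fun s => x - s)) => //; last exact: within_funX.
by move=> s; apply: continuousB => //; exact: cst_continuous.
Qed.

Lemma within_parts x k p m : {within `[0, 1], continuous (parts_primitive x k p m)}.
Proof.
elim: p m => [|p IH] m.
  by rewrite (_ : parts_primitive _ _ _ _ = iprim m.+1 k) //; exact: within_iprim.
rewrite (_ : parts_primitive _ _ _ _ = fun s => iprim m.+1 k s * ((x - s) ^+ p.+1 / p.+1`!%:R)
  + parts_primitive x k p m.+1 s) //.
apply: within_funD => //; apply: within_funM; first exact: within_iprim.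
by apply: within_funM; [exact: within_subX|exact: within_cst].
Qed.

Lemma parts_at0 x k p m : parts_primitive x k p m 0 = 0.
Proof.
elim: p m => [|p IH] m; first exact: (iprim_at0 m.+1 k).
rewrite -[LHS]/(iprim m.+1 k 0 * _ + parts_primitive x k p m.+1 0).
by rewrite IH iprim_at0 mul0r addr0.
Qed.

(** With [parts_at0] and [is_derive_parts], this is Cauchy's formula for repeated integration: at
    [s = x] every boundary term but the last has a vanishing factor. *)
Lemma parts_at x k p m : parts_primitive x k p m x = iprim (m + p).+1 k x.
Proof.
elim: p m => [|p IH] m; first by rewrite addn0.
by rewrite /= IH subrr expr0n mul0r mulr0 add0r addSnnS.
Qed.

(** The remainder of the expansion of [geom k s], weighted by [(x - s)^p / p!], is integrated over
    [[0, x]] by a mean value estimate on the explicit primitive [H]. *)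
Lemma iprim_partial k x p (N : nat) : 0 < x < 1 ->
  `|iprim p.+1 k x - geom k x * (x ^+ p.+1 / p`!%:R) *
      \sum_(0 <= r < N) (x / (1 + x)) ^+ r * meixner x k r / (p.+1 + r)%:R|
  <= geom k x * (x ^+ p.+1 / p`!%:R) * inner_error x k N.
Proof.
move=> x01; have [x0 x1] := andP x01; have x1_gt0 : 0 < 1 + x by rewrite addr_gt0.
have xn0 : x != 0 by rewrite gt_eqF.
(* A termwise primitive of the weighted partial sum, vanishing at [s = x]. *)
pose G s := \sum_(0 <= r < N) (- (geom k x / p`!%:R * ((1 + x)^-1 ^+ r * meixner x k r / (p.+1 + r)%:R)))
   * (x - s) ^+ (p.+1 + r).
pose dG s := \sum_(0 <= r < N) (- (geom k x / p`!%:R * ((1 + x)^-1 ^+ r * meixner x k r / (p.+1 + r)%:R)))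
   * (- (p.+1 + r)%:R * (x - s) ^+ (p + r)).
have dGE s : dG s = (x - s) ^+ p / p`!%:R *
    (geom k x * \sum_(0 <= r < N) ((x - s) / (1 + x)) ^+ r * meixner x k r).
  rewrite /dG !mulr_sumr; apply: eq_bigr => r _; rewrite exprD expr_div_n exprVn.
  by field; rewrite expf_neq0 ?gt_eqF //= nat1r -natrD pnatr_eq0 -lt0n fact_gt0.
pose H s := parts_primitive x k p 0 s - G s.
have H0 : H 0 = geom k x * (x ^+ p.+1 / p`!%:R) *
      \sum_(0 <= r < N) (x / (1 + x)) ^+ r * meixner x k r / (p.+1 + r)%:R.
  rewrite /H parts_at0 sub0r /G -sumrN mulr_sumr; apply: eq_bigr => r _.
  by rewrite subr0 exprD expr_div_n exprVn; ring.
have Hx : H x = iprim p.+1 k x.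
  rewrite /H parts_at add0n /G big1 ?subr0 // => r _.
  by rewrite subrr addSn expr0n mulr0.
rewrite -Hx -H0.
have -> : geom k x * (x ^+ p.+1 / p`!%:R) * inner_error x k N =
    x ^+ p / p`!%:R * (geom k x * inner_error x k N) * (x - 0).
  by rewrite subr0 exprS; ring.
apply: (@derivative_bound _ _ (fun s => (x - s) ^+ p / p`!%:R * iprim 0 k s - dG s)).
- exact: ltW.
- apply: within_funB; first by apply: within_segmentS (lexx 0) (ltW x1) _; exact: within_parts.
  by apply: within_funsum => r _; apply: within_funZ; exact: within_subX.
- move=> s /andP[s0 sx]; apply: is_derive_funB.
    by apply: is_derive_parts; rewrite s0 (lt_trans sx).
  by apply: is_derive_funsum => r _; apply: is_derive_funZ; exact: is_derive_subX.
- move=> s /andP[s0 sx]; rewrite dGE -mulrBr normrM.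
  have e0 : 0 <= (x - s) ^+ p / p`!%:R by rewrite divr_ge0 // exprn_ge0 // subr_ge0 ltW.
  rewrite (ger0_norm e0); apply: ler_pM => //.
    rewrite ler_pM2r ?invr_gt0 ?ltr0n ?fact_gt0 //.
    by rewrite lerXn2r ?nnegrE ?subr_ge0 ?(ltW sx) ?(ltW x0) // gerBl ltW.
  by apply: geom_partial => //; rewrite !ltW.
Qed.

Lemma cvg_inner_series k n x : 0 < x < 1 -> (0 < n)%N ->
  (fun N => \sum_(0 <= r < N) inner_term x k n r) @ \oo -->
  n`!%:R * iprim n k x / (geom k x * x ^+ n).
Proof.
case: n => // p x01 _; have [x0 x1] := andP x01.
have x1_gt0 : 0 < 1 + x by rewrite addr_gt0.
have itE r : inner_term x k p.+1 r = p.+1%:R * ((x / (1 + x)) ^+ r * meixner x k r / (p.+1 + r)%:R).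
  rewrite /inner_term pochhammer_ratio // hypergeometric_opp_opp -/(meixner x k r).
  have -> : 1 - 1 / (1 + x) = x / (1 + x) by field; rewrite gt_eqF.
  by ring.
under eq_fun do under eq_bigr do rewrite itE.
have g0 : 0 < geom k x * x ^+ p.+1 by rewrite mulr_gt0 ?geom_gt0 ?exprn_gt0.
apply/cvgrPdist_le => e e0.
(* Passing from [iprim_partial] to the normalised series multiplies the error by [(p + 1)! / p!]. *)
have /cvgrPdist_le/(_ (e / p.+1%:R)) := cvg_inner_error k x0.
case; first by rewrite divr_gt0.
move=> N _ hN; exists N => // M /= NM; have := hN M NM; rewrite sub0r normrN.
rewrite ler_pdivlMr // => /(le_trans _) hle; rewrite -mulr_sumr.
have -> : p.+1`!%:R * iprim p.+1 k x / (geom k x * x ^+ p.+1) - p.+1%:R *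
    \sum_(0 <= r < M) (x / (1 + x)) ^+ r * meixner x k r / (p.+1 + r)%:R =
    p.+1`!%:R / (geom k x * x ^+ p.+1) * (iprim p.+1 k x - geom k x * (x ^+ p.+1 / p`!%:R) *
      \sum_(0 <= r < M) (x / (1 + x)) ^+ r * meixner x k r / (p.+1 + r)%:R).
  rewrite factS natrM; field.
  by rewrite pnatr_eq0 -lt0n fact_gt0 expf_neq0 ?gt_eqF ?geom_gt0.
have c0 : 0 < p.+1`!%:R / (geom k x * x ^+ p.+1) by rewrite divr_gt0 // ltr0n fact_gt0.
rewrite normrM (gtr0_norm c0) (le_trans (ler_wpM2l (ltW c0) (iprim_partial _ _ _ x01))) //.
apply: hle; rewrite le_eqVlt; apply/orP; left; apply/eqP.
rewrite ger0_norm; last first.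
  apply: sumr_ge0 => i _; rewrite mulr_ge0 ?mulr_ge0 ?exprn_ge0 ?divr_ge0 ?(ltW x0) //.
  apply: le_trans (@bin_tail_le (x / (1 + x)) _ _ _ _ _); rewrite ?normr_ge0 //.
    by rewrite divr_ge0 ?(ltW x0) ?(ltW x1_gt0) //=.
  by rewrite ltr_pdivrMr // mul1r ltrDr.
rewrite factS natrM; field.
by rewrite pnatr_eq0 -lt0n fact_gt0 expf_neq0 ?gt_eqF ?geom_gt0.
Qed.

End InnerSeries.

(** * The backward equation *)

Section BackwardEquation.
Context {R : realType} {S : countType}.
Variables (p : R -> S -> S -> R) (q : S -> S -> R).
Hypothesis ptf : is_transition_function p.
Hypothesis prates : has_transition_rates q p.
Implicit Types (x y z : S) (r : seq S) (h t : R).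

Lemma esum_seqID r (f : S -> \bar R) : uniq r -> (forall z, 0 <= f z)%E ->
  (\esum_(z in [set: S]) f z = \sum_(z <- r) f z + \esum_(z in ~` [set` r]) f z)%E.
Proof.
move=> ur f0; rewrite (esumID [set` r]) // setTI setTI esum_fset //.
  by rewrite -fsbig_seq.
exact: finite_seq.
Qed.

Lemma tail_mass r t x : uniq r -> 0 <= t ->
  \esum_(z in ~` [set` r]) (p t x z)%:E = (1 - \sum_(z <- r) p t x z)%:E.
Proof.
move=> ur t0; have := tf_mass1 ptf x t0.
rewrite (esum_seqID ur) => [|z]; last by rewrite lee_fin (tf_ge0 ptf).
rewrite sumEFin EFinB => <-; rewrite addeAC subee ?add0e //.
Qed.

Lemma transition_le1 t x y : 0 <= t -> p t x y <= 1.
Proof.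
move=> t0; rewrite -subr_ge0; have := @tail_mass [:: y] t x isT t0.
rewrite big_seq1 -lee_fin => <-; apply: esum_ge0 => z _.
by rewrite lee_fin (tf_ge0 ptf).
Qed.

(** The intermediate states outside the finite list contribute at most the mass that [p h x] gives
    them, since transition probabilities are at most [1]. *)
Lemma chapman_kolmogorov_tail r h t x y : uniq r -> 0 <= h -> 0 <= t ->
  0 <= p (h + t) x y - \sum_(z <- r) p h x z * p t z y <= 1 - \sum_(z <- r) p h x z.
Proof.
move=> ur h0 t0; have := tf_chapman_kolmogorov ptf x y h0 t0.
have pp z : (0 <= (p h x z * p t z y)%:E)%E by rewrite lee_fin mulr_ge0 ?(tf_ge0 ptf).
rewrite (esum_seqID ur) // sumEFin => ck.
have tailE : (p (h + t) x y - \sum_(z <- r) p h x z * p t z y)%:E =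
    \esum_(z in ~` [set` r]) (p h x z * p t z y)%:E.
  by rewrite EFinB ck addeAC subee ?add0e.
rewrite -2!lee_fin tailE -tail_mass //; apply/andP; split; first exact: esum_ge0.
apply: le_esum => z _; rewrite lee_fin ler_piMr ?(tf_ge0 ptf) //.
exact: transition_le1.
Qed.

Lemma cvg_exit x : 1 - p h x x @[h --> 0^'+] --> (0 : R).
Proof.
have c : (1 - p h x x) / h * h @[h --> 0^'+] --> exit_rate q x * 0.
  apply: cvgM; first exact: (@rates_diagonal _ _ _ _ prates x).
  by apply: cvg_at_right_filter; exact: cvg_id.
rewrite mulr0 in c; apply: cvg_trans c; apply: near_eq_cvg; near=> h.
by rewrite /= divfK // gt_eqF //; near: h; exact: nbhs_right_gt.
Unshelve. all: by end_near. Qed.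

(** The case of the single intermediate state [x]. The bound does not involve [t], so it serves for
    continuity from both sides. *)
Lemma transition_modulus h t x y : 0 <= h -> 0 <= t ->
  `|p (h + t) x y - p t x y| <= 1 - p h x x.
Proof.
move=> h0 t0; have := @chapman_kolmogorov_tail [:: x] h t x y isT h0 t0.
rewrite !big_seq1 => /andP[lo hi].
have := transition_le1 x x h0; have := transition_le1 x y t0.
have := tf_ge0 ptf x x h0; have := tf_ge0 ptf x y t0.
by rewrite ler_norml => *; apply/andP; split; nra.
Qed.

Lemma cvg_transition_right t x y : 0 <= t -> p (h + t) x y @[h --> 0^'+] --> p t x y.
Proof.
move=> t0; apply/cvgrPdist_le => e e0.
have /cvgrPdist_le/(_ e e0) := cvg_exit x; apply: filterS2 (nbhs_right_gt 0) => h h0.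
rewrite sub0r normrN => /(le_trans _); apply; rewrite distrC.
exact: le_trans (transition_modulus x y (ltW h0) t0) (ler_norm _).
Qed.

Lemma cvg_transition_left t x y : 0 < t -> p (t - h) x y @[h --> 0^'+] --> p t x y.
Proof.
move=> t0; apply/cvgrPdist_le => e e0.
have /cvgrPdist_le/(_ e e0) := cvg_exit x; apply: filterS3 (nbhs_right_gt 0) (nbhs_right_lt t0).
move=> h h0 ht; rewrite sub0r normrN => /(le_trans _); apply.
have th0 : 0 <= t - h by rewrite subr_ge0 ltW.
by have := transition_modulus x y (ltW h0) th0; rewrite subrKC => /le_trans; apply; exact: ler_norm.
Qed.

Variable r : S -> seq S.
Hypothesis r_uniq : forall x, uniq (r x).
Hypothesis r_neq : forall x, x \notin r x.
Hypothesis exitE : forall x, exit_rate q x = \sum_(z <- r x) q x z.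

Definition backward y t x := \sum_(z <- r x) q x z * (p t z y - p t x y).

Lemma backward_increment h t x y : 0 <= h -> 0 <= t ->
  `|p (h + t) x y - p t x y -
    (\sum_(z <- r x) p h x z * p t z y - (1 - p h x x) * p t x y)| <=
  (1 - p h x x) - \sum_(z <- r x) p h x z.
Proof.
move=> h0 t0; have := @chapman_kolmogorov_tail (x :: r x) h t x y _ h0 t0.
rewrite /= r_neq r_uniq !big_cons => /(_ isT) /andP[lo hi].
by rewrite ger0_norm; lra.
Qed.

(** The base time [tau h] may move with [h]: a constant one yields the right derivative, [t - h] the
    left one. *)
Lemma cvg_increment (tau : R -> R) t x y :
  (\forall h \near 0^'+, 0 <= tau h) ->
  (forall z, p (tau h) z y @[h --> 0^'+] --> p t z y) ->
  (p (h + tau h) x y - p (tau h) x y) / h @[h --> 0^'+] --> backward y t x.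
Proof.
move=> tau0 ptau.
have crate z : z \in r x -> p h x z / h @[h --> 0^'+] --> q x z.
  by move=> zr; apply: (@rates_off_diagonal _ _ _ _ prates); apply: contraNneq (r_neq x) => {1}->.
pose main h := \sum_(z <- r x) p h x z / h * p (tau h) z y - (1 - p h x x) / h * p (tau h) x y.
have cmain : main h @[h --> 0^'+] --> backward y t x.
  have -> : backward y t x = \sum_(z <- r x) q x z * p t z y - exit_rate q x * p t x y.
    rewrite exitE mulr_suml -sumrB; apply: eq_bigr => z _; exact: mulrBr.
  apply: cvgB; last by apply: cvgM => //; exact: (@rates_diagonal _ _ _ _ prates x).
  rewrite big_seq; under eq_fun do rewrite big_seq.
  apply: cvg_big => [|z zr]; first exact: add_continuous.
  by apply: cvgM => //; exact: crate.
(* By [exitE] the exit rate is the total rate to the listed neighbours, so being anywhere else after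
   time [h] has probability [o(h)]. *)
have crho : (1 - p h x x) / h - \sum_(z <- r x) p h x z / h @[h --> 0^'+] --> (0 : R).
  rewrite -[X in _ --> X](subrr (exit_rate q x)) {2}exitE.
  apply: cvgB; first exact: (@rates_diagonal _ _ _ _ prates x).
  rewrite big_seq; under eq_fun do rewrite big_seq.
  by apply: cvg_big => [|z zr]; [exact: add_continuous|exact: crate].
rewrite -[X in _ --> X]addr0.
have -> : (fun h => (p (h + tau h) x y - p (tau h) x y) / h) =
    (fun h => main h + ((p (h + tau h) x y - p (tau h) x y) / h - main h)).
  by apply/funext => h; rewrite subrKC.
apply: cvgD => //; apply/cvgrPdist_le => e e0.
move/cvgrPdist_le : crho => /(_ e e0); apply: filterS3 (nbhs_right_gt 0) tau0 => h h0 tau0.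
rewrite !sub0r !normrN => /(le_trans _); apply; apply: le_trans (ler_norm _).
have -> : main h = (\sum_(z <- r x) p h x z * p (tau h) z y - (1 - p h x x) * p (tau h) x y) / h.
  rewrite /main [RHS]mulrBl mulr_suml; congr (_ - _); last by rewrite mulrAC.
  by apply: eq_bigr => z _; rewrite mulrAC.
rewrite -mulrBl -mulr_suml -mulrBl normrM [`|h^-1|]gtr0_norm ?invr_gt0 //.
rewrite ler_pM2r ?invr_gt0 //; exact: backward_increment (ltW h0) tau0.
Qed.

Lemma backward_equation t x y : 0 < t ->
  is_derive t 1 (fun s => p s x y) (backward y t x).
Proof.
move=> t0.
have quotE : (fun h => h^-1 *: (p (h *: 1 + t) x y - p t x y)) =
    (fun h => (p (h + t) x y - p t x y) / h).
  by apply/funext => h; rewrite /GRing.scale /= mulr1 mulrC.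
have cright : h^-1 *: (p (h *: 1 + t) x y - p t x y) @[h --> 0^'+] --> backward y t x.
  rewrite quotE; apply: (cvg_increment (tau := fun=> t)); last by move=> z; exact: cvg_cst.
  by near=> h; exact: ltW.
have cleft : h^-1 *: (p (h *: 1 + t) x y - p t x y) @[h --> 0^'-] --> backward y t x.
  apply/cvg_at_leftNP; rewrite oppr0.
  have tau0 : \forall h \near 0^'+, 0 <= t - h.
    by near=> h; rewrite subr_ge0 ltW //; near: h; exact: nbhs_right_lt.
  rewrite quotE (_ : _ \o _ = fun h => (p (h + (t - h)) x y - p (t - h) x y) / h).
    exact: (cvg_increment tau0 (fun z => @cvg_transition_left t z y t0)).
  apply/funext => h /=.
  by rewrite subrKC (addrC _ t) invrN mulrN -mulNr opprB.
have cv : h^-1 *: (p (h *: 1 + t) x y - p t x y) @[h --> 0^'] --> backward y t x.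
  exact: (@cvg_at_right_left_dnbhs _ R^o).
apply: DeriveDef; first by apply/cvg_ex; exists (backward y t x).
exact: cvg_lim cv.
Unshelve. all: by end_near. Qed.

Lemma within_transition x y b : {within `[0, b], continuous (fun t => p t x y)}.
Proof.
have [b0|] := ltP 0 b; last first.
  rewrite le_eqVlt => /predU1P[->|b0].
    by rewrite set_itv1; exact: continuous_subspace1.
  by rewrite set_itv_ge ?bnd_simp -?ltNge //; exact: continuous_subspace0.
have ct t : 0 < t -> {for t, continuous (fun t => p t x y)}.
  move=> t0; apply: differentiable_continuous; apply/derivable1_diffP.
  by have [] := backward_equation x y t0.
apply/(continuous_within_itvP _ b0); split.
- by move=> t; rewrite in_itv /= => /andP[t0 _]; exact: ct.
- have := @cvg_transition_right 0 x y (lexx _).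
  by under eq_fun do rewrite addr0.
- by apply: cvg_at_left_filter; exact: ct.
Qed.

End BackwardEquation.

(** * The backward equation on the rays, summed over levels *)

Section RayChain.
Context {R : realType}.
Variables (d : nat) (l : R).
Hypothesis d_gt0 : (0 < d)%N.
Hypothesis l_gt0 : 0 < l.

(** [Some (k, j)] lies on level [k + 1], so its lower neighbour is [ray_point k j], which is the
    origin when [k = 0]. *)
Definition neighbours (x : state d) : seq (state d) :=
  match x with
  | None => [seq ray_point 1 j | j <- enum 'I_d]
  | Some (k, j) => [:: ray_point k.+2 j; ray_point k j]
  end.

Lemma neighbours_uniq x : uniq (neighbours x).
Proof.
case: x => [[[|k] j]|] //=; first by rewrite inE andbT; apply/eqP => -[]; lia.
by rewrite map_inj_uniq ?enum_uniq // => i j [].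
Qed.

Lemma neighbours_neq x : x \notin neighbours x.
Proof.
case: x => [[k j]|] /=; apply/negP; last by move=> /mapP[].
by rewrite !inE => /orP[/eqP[]|]; [lia|case: k => [|k] /eqP // []; lia].
Qed.

Lemma rate_neq0 x y : rate l l l x y != 0 -> y \in neighbours x.
Proof.
case: x => [[k j]|] /=; last first.
  case: ifP => [/existsP[j /eqP ->] _|]; last by rewrite eqxx.
  by apply/mapP; exists j; rewrite ?mem_enum.
case: ifP => [/eqP -> _|_]; first by rewrite mem_head.
by case: ifP => [/eqP -> _|_ /eqP //]; rewrite !inE eqxx orbT.
Qed.

Lemma exit_rateE x : exit_rate (rate l l l) x = \sum_(z <- neighbours x) rate l l l x z.
Proof.
rewrite fsbig_seq; last exact: neighbours_uniq.
rewrite /exit_rate; symmetry; apply: fsbig_widen => z /=.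
  by move=> zx; apply: contraTneq zx => ->; exact: neighbours_neq.
by move=> [_ zx]; apply/eqP; apply: contra_notT zx; exact: rate_neq0.
Qed.

Variable p : R -> state d -> state d -> R.
Hypothesis ptf : is_transition_function p.
Hypothesis prates : has_transition_rates (rate l l l) p.
Variables (k : nat) (j0 : 'I_d).
Let y : state d := Some (k, j0).

(** The target [y] is fixed and the starting states of a level are summed, as the backward equation
    requires; time is scaled to [lambda = 1]. *)
Definition level_sum (m : nat) (u : R) : R :=
  if m is m'.+1 then \sum_(j < d) p (u / l) (Some (m', j)) y else p (u / l) None y.

Lemma level_sum_le m (u : R) : 0 <= u -> `|level_sum m u| <= d%:R.
Proof.
move=> u0; have ul : 0 <= u / l by rewrite divr_ge0 // ltW.
have p01 x : `|p (u / l) x y| <= 1.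
  by rewrite ger0_norm ?(tf_ge0 ptf) // (transition_le1 ptf).
case: m => [|m] /=; first by rewrite (le_trans (p01 _)) // ler1n.
apply: (le_trans (ler_norm_sum _ _ _)); apply: (@le_trans _ _ (\sum_(j < d) 1)).
  exact: ler_sum.
by rewrite sumr_const card_ord.
Qed.

Lemma level_sum_at0 m : level_sum m 0 = (m == k.+1)%:R.
Proof.
case: m => [|m] /=; rewrite mul0r ?(tf_start ptf) //.
rewrite (eq_bigr (fun j => ((m == k) && (j == j0))%:R)); last first.
  by move=> j _; rewrite (tf_start ptf).
rewrite eqSS; case: (m == k); last by rewrite big1.
rewrite (bigD1 j0) //= eqxx big1 ?addr0 // => j /negPf -> //.
Qed.

Lemma within_level_sum m b : {within `[0, b], continuous (level_sum m)}.
Proof.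
have cp x : {within `[0, b], continuous (fun u => p (u / l) x y)}.
  apply: (@within_comp _ _ `[0, b / l] (fun t => p t x y) (fun u => u / l)).
  - by move=> u; apply: cvgMr_tmp; exact: cvg_id.
  - move=> u /=; rewrite !in_itv /= => /andP[u0 ub].
    by rewrite divr_ge0 ?(ltW l_gt0) //= ler_pM2r // invr_gt0.
  - exact: (within_transition ptf prates neighbours_uniq neighbours_neq exit_rateE).
case: m => [|m]; first exact: cp.
(* The sum over ordinals becomes a sum over an interval of integers, with a default value [0] never
   met there. *)
rewrite (_ : level_sum m.+1 = fun u =>
    \sum_(0 <= i < d) (if insub i is Some j then p (u / l) (Some (m, j)) y else 0)).
  apply: within_funsum => i _; case: insub => [j|]; [exact: cp|exact: within_cst].
apply/funext => u; rewrite big_mkord /=; apply: eq_bigr => j _.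
by rewrite valK.
Qed.

(** Compared with [d = 1], the origin is left towards [d] rays, and it is the lower neighbour of all
    [d] states of level [1]: hence the corrections by [d - 1] at these two levels. *)
Lemma is_derive_level_sum m (u : R) : 0 < u -> is_derive u 1 (level_sum m)
  (gen (level_sum^~ u) m + (d%:R - 1) * ((m == 1)%:R - (m == 0)%:R) * level_sum 0%N u).
Proof.
move=> u0; have ul : 0 < u / l by rewrite divr_gt0.
have l0 : l != 0 by rewrite gt_eqF.
have dp x : is_derive u 1 (fun u => p (u / l) x y)
    (backward p (rate l l l) neighbours y (u / l) x * l^-1).
  have dl : is_derive u 1 (fun u => u / l) (l^-1).
    have := is_derive_funM (is_derive_id u 1) (is_derive_funcst l^-1 u).
    by rewrite mulr0 addr0 mul1r.
  apply: (is_derive_funcomp (f := fun t => p t x y) dl).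
  exact: (backward_equation ptf prates neighbours_uniq neighbours_neq exit_rateE).
case: m => [|m].
  have := dp None; congr (is_derive _ _ _ _).
  rewrite /backward /= big_map big_enum /=.
  rewrite (eq_bigr (fun j => l * (p (u / l) (Some (0%N, j)) y - p (u / l) None y))); last first.
    by move=> j _; case: existsP => // -[]; exists j.
  rewrite -mulr_sumr sumrB sumr_const card_ord -[_ *+ d]mulr_natl /gen /=; field.
  exact: l0.
rewrite (_ : level_sum m.+1 = fun u =>
    \sum_(0 <= i < d) (if insub i is Some j then p (u / l) (Some (m, j)) y else 0)); last first.
  by apply/funext => v; rewrite big_mkord /=; apply: eq_bigr => j _; rewrite valK.
have := @is_derive_funsum _ 0 d
  (fun i v => if insub i is Some j then p (v / l) (Some (m, j)) y else 0)
  (fun i => if insub i is Some j then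
     backward p (rate l l l) neighbours y (u / l) (Some (m, j)) * l^-1 else 0) u.
have h i : (0 <= i < d)%N -> is_derive u 1
  (fun v => if insub i is Some j then p (v / l) (Some (m, j)) y else 0)
  (if insub i is Some j then
     backward p (rate l l l) neighbours y (u / l) (Some (m, j)) * l^-1 else 0).
  by move=> _; case: insub => [j|]; [exact: dp|exact: is_derive_funcst].
move=> /(_ h); congr (is_derive _ _ _ _); rewrite big_mkord.
(* [P 0] counts the origin [d] times, unlike [level_sum 0]; the difference is the correction at
   level [1]. *)
pose P i := \sum_(j < d) p (u / l) (ray_point i j) y.
transitivity (m.+2%:R * (P m.+2 - P m.+1) + m.+1%:R * (P m - P m.+1)).
  rewrite -!sumrB !mulr_sumr -big_split /=; apply: eq_bigr => j _.
  rewrite valK /backward /= !big_cons big_nil addr0 eqxx.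
  rewrite (_ : ray_point m j == Some (m.+1, j) = false); last first.
    by apply/eqP; case: (m) => [//|i] []; lia.
  by rewrite eqxx /= -natr1; field.
rewrite /gen /=; case: m {h} => [|m]; rewrite /P /=.
  rewrite sumr_const card_ord -[_ *+ d]mulr_natl; ring.
by rewrite subrr mulr0 mul0r addr0.
Qed.

Lemma transition_approx (a : nat -> R) (t : R) (K : nat) :
  (forall n, 0 <= a n) ->
  (forall n, (0 < n)%N ->
    a n = d%:R * n`!%:R + (d%:R - 1) * \sum_(1 <= b < n) a b * (n - b)`!%:R) ->
  0 < t -> t < 1 / l ->
  `|p t None y - level_approx a d%:R K k.+1 (l * t)| <=
  d%:R * ((d%:R - 1) * (a K.+1 * (l * t) ^+ K / K`!%:R)) * (l * t).
Proof.
move=> a0 arec t0 tl; have lt01 : 0 < l * t < 1.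
  by rewrite mulr_gt0 //= mulrC -ltr_pdivlMr.
have := @pairing _ a d%:R _ a0 arec level_sum (l * t) d%:R k.+1 lt01.
rewrite /= mulrAC divff ?gt_eqF // mul1r; apply.
- by rewrite ler1n.
- by move=> m; exact: within_level_sum.
- by move=> m u /andP[u0 _]; exact: is_derive_level_sum.
- by move=> m u /andP[u0 _]; exact: level_sum_le.
- exact: level_sum_at0.
Qed.

End RayChain.

(** * The outer series and the conclusion *)

Section OuterSeries.
Context {R : realType}.
Variables (d k : nat) (x : R).
Hypothesis d_gt0 : (0 < d)%N.
Hypothesis x01 : 0 < x < 1.

Let x0 : 0 < x. Proof. by case/andP: x01. Qed.
Let x1 : x < 1. Proof. by case/andP: x01. Qed.
Let a n : R := (cut_weight d n)%:R.

Lemma cut_weight_recR n : (0 < n)%N ->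
  a n = d%:R * n`!%:R + (d%:R - 1) * \sum_(1 <= b < n) a b * (n - b)`!%:R.
Proof.
move=> n0; rewrite /a cut_weight_rec // natrD !natrM natr_sum -subn1 natrB //.
by congr (_ + _ * _); apply: eq_bigr => b _; rewrite natrM.
Qed.

Lemma outer_term_iprim n : (0 < n)%N ->
  outer_term x d k n = (-1) ^+ n * a n * iprim n k x / geom k x.
Proof.
move=> n0; rewrite /outer_term (cvg_lim (@Rhausdorff R) (cvg_inner_series (k := k) x01 n0)).
rewrite (eq_bigr (fun j => (perm_components n j * d ^ j)%:R)); last first.
  by move=> j _; rewrite natrM natrX.
rewrite -natr_sum perm_components_sum // -/(a n) (exprNn x); field.
by rewrite expf_neq0 ?gt_eqF ?geom_gt0 //= pnatr_eq0 -lt0n fact_gt0.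
Qed.

Lemma level_approxE K :
  d%:R * level_approx a d%:R K k x =
  geom k x * (d%:R + (d%:R - 1) * \sum_(1 <= n < K.+1) outer_term x d k n).
Proof.
have g0 : geom k x != 0 by rewrite gt_eqF ?geom_gt0.
have d0 : d%:R != 0 :> R by rewrite pnatr_eq0 -lt0n.
have -> : \sum_(1 <= n < K.+1) outer_term x d k n =
    (\sum_(1 <= n < K.+1) (-1) ^+ n * a n * iprim n k x) / geom k x.
  rewrite mulr_suml !big_nat; apply: eq_bigr => n /andP[n0 _].
  exact: outer_term_iprim.
by rewrite /level_approx; field; rewrite g0.
Qed.

(** The growth of [a_n] against [x^n / n!], the bound on the iterated primitive, leaves a polynomial
    times [x^n]. *)
Lemma outer_term_le n :
  `|outer_term x d k n| <= d%:R ^+ 2 / geom k x * ('C(n + d.-1, d.-1)%:R * x ^+ n).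
Proof.
have g0 := geom_gt0 k x0.
case: n => [|n].
  rewrite /outer_term big_geq // mulr0 mul0r normr0.
  exact: mulr_ge0 (divr_ge0 (sqr_ge0 _) (ltW g0)) (mulr_ge0 (ler0n _ _) (exprn_ge0 _ (ltW x0))).
rewrite outer_term_iprim // !normrM normrX normrN1 expr1n mul1r.
rewrite (ger0_norm (x := a _)) ?ler0n // (gtr0_norm (x := _^-1)) ?invr_gt0 //.
have ax : a n.+1 <= d%:R ^+ 2 * n.+1`!%:R * 'C(n.+1 + d.-1, d.-1)%:R.
  by rewrite -natrX -!natrM ler_nat; exact: cut_weight_le.
have ix : `|iprim n.+1 k x| <= x ^+ n.+1 / n.+1`!%:R.
  apply: le_trans (iprim_le _ _ _) _; first by rewrite !ltW.
  rewrite -mulrA ler_piMl ?divr_ge0 ?exprn_ge0 ?(ltW x0) //.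
  by rewrite exprn_ile1 ?invr_ge0 // invf_le1 ?ltr0n // ler1n.
apply: (@le_trans _ _ (d%:R ^+ 2 * n.+1`!%:R * 'C(n.+1 + d.-1, d.-1)%:R *
    (x ^+ n.+1 / n.+1`!%:R) / geom k x)).
  by rewrite ler_pM2r ?invr_gt0 //; apply: ler_pM; rewrite ?ler0n.
rewrite le_eqVlt; apply/orP; left; apply/eqP; field.
by rewrite gt_eqF //= pnatr_eq0 -lt0n fact_gt0.
Qed.

Lemma cvg_outer_series : cvgn (fun m => \sum_(1 <= n < m) outer_term x d k n).
Proof.
rewrite is_cvg_series_restrict; apply: normed_cvg.
pose p := d.-1; pose v n : R := 'C(n + p, p)%:R * x ^+ n.
have cv : cvgn (series v).
  have : cvgn (series (fun r => 'C(r, p)%:R * x ^+ r)).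
    by apply/cvg_ex; eexists; apply: cvg_series_bin; rewrite x1 ltW.
  (* The terms ['C(n + p, p) x^n] are those of the binomial series from index [p] on, divided by
     [x^p]. *)
  rewrite -(is_cvg_series_restrict p) => /cvg_ex[/= s].
  rewrite -(cvg_shiftn p) => cs; apply/cvg_ex; exists (s / x ^+ p).
  rewrite (_ : series v = fun n => (\sum_(p <= r < n + p) 'C(r, p)%:R * x ^+ r) / x ^+ p).
    by apply: cvgMl.
  apply/funext => n; rewrite -{1}[p]add0n big_addn addnK mulr_suml.
  by apply: eq_bigr => i _; rewrite exprD mulrA mulfK // expf_neq0 // gt_eqF.
apply: (@series_le_cvg _ _ (fun n => d%:R ^+ 2 / geom k x * v n)) => [n|n|n|].
- exact: normr_ge0.
- by rewrite !mulr_ge0 ?invr_ge0 ?exprn_ge0 ?(ltW x0) ?(ltW (geom_gt0 _ _)).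
- exact: outer_term_le.
- exact: is_cvg_seriesZ.
Qed.

Lemma cvg_approx_error :
  (fun K => d%:R * ((d%:R - 1) * (a K.+1 * x ^+ K / K`!%:R)) * x) @ \oo --> (0 : R).
Proof.
have fact_neq0 n : n`!%:R != 0 :> R by rewrite pnatr_eq0 -lt0n fact_gt0.
(* The third factor [d] comes from [K.+1 * 'C(K + d, d.-1) = d * 'C(K + d, d)], and [x^d] from
   writing [x^K] as [x^(K + d) / x^d]. *)
pose C : R := d%:R * (d%:R - 1) * d%:R ^+ 3 * x / x ^+ d.
have C0 : 0 <= C.
  by rewrite !mulr_ge0 ?invr_ge0 ?exprn_ge0 ?subr_ge0 ?ler1n ?(ltW x0).
have cB : (fun K => C * ('C(K + d, d)%:R * x ^+ (K + d))) @ \oo --> (0 : R).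
  rewrite -[X in _ --> X](mulr0 C); apply: cvgMr.
  rewrite (cvg_shiftn d (fun r => 'C(r, d)%:R * x ^+ r)).
  by apply: cvg_bin_exp; rewrite x1 ltW.
apply: (@squeeze_cvgr _ _ _ _ (fun=> 0)
  (fun K => C * ('C(K + d, d)%:R * x ^+ (K + d)))) => //; last exact: cvg_cst.
apply: nearW => K; apply/andP; split.
  by rewrite !mulr_ge0 ?invr_ge0 ?exprn_ge0 ?subr_ge0 ?ler1n ?(ltW x0).
have aK : a K.+1 <= d%:R ^+ 3 * K`!%:R * 'C(K + d, d)%:R.
  rewrite -natrX -!natrM ler_nat.
  apply: (leq_trans (cut_weight_le d_gt0 (ltn0Sn K))); set p := d.-1.
  have dp : d = p.+1 by rewrite /p prednK.
  have binE : (d * 'C(K + d, d) = K.+1 * 'C(K.+1 + p, p))%N.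
    by rewrite dp mul_bin_left addnS -addSn addnK.
  rewrite leq_eqVlt factS; apply/orP; left; apply/eqP.
  transitivity (d ^ 2 * K`! * (K.+1 * 'C(K.+1 + p, p)))%N; first by ring.
  by rewrite -binE; ring.
apply: (@le_trans _ _ (d%:R * ((d%:R - 1) * (d%:R ^+ 3 * K`!%:R * 'C(K + d, d)%:R * x ^+ K / K`!%:R)) * x)).
  rewrite ler_pM2r //; apply: ler_wpM2l => //; apply: ler_wpM2l; first by rewrite subr_ge0 ler1n.
  by rewrite ler_pM2r ?invr_gt0 ?ltr0n ?fact_gt0 // ler_wpM2r // exprn_ge0 // ltW.
rewrite le_eqVlt; apply/orP; left; apply/eqP; rewrite /C exprD; field.
by rewrite fact_neq0 expf_neq0 // gt_eqF.
Qed.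

End OuterSeries.

(** * From the process to its transition function *)

Section Chain.
Context {R : realType} {disp : measure_display} {T : measurableType disp}.

(** The Markov property for the times [0] and [t]; the conditioning event has probability [1]. *)
Lemma state_prob_transition (P : probability T R) (d : nat)
    (X : R -> T -> state d) (p : R -> state d -> state d -> R) (k : nat) (j : 'I_d) (t : R) :
  P [set w | X 0 w = origin d] = 1%E ->
  (forall (n : nat) (s : nat -> R) (x : nat -> state d),
    0 <= s 0%N -> (forall i, (i <= n)%N -> s i < s i.+1) ->
    P [set w | forall i, (i <= n.+1)%N -> X (s i) w = x i] =
    (P [set w | forall i, (i <= n)%N -> X (s i) w = x i]
       * (p (s n.+1 - s n) (x n) (x n.+1))%:E)%E) ->
  0 < t -> state_prob P X k j t = p t (origin d) (ray_point k j).
Proof.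
move=> P0 markov t0.
have := markov 0%N (fun i => i%:R * t) (fun i => if i is 0 then origin d else ray_point k j).
rewrite mul0r lexx => /(_ isT).
have -> : [set w | forall i, (i <= 0)%N -> X (i%:R * t) w = if i is 0 then origin d else ray_point k j]
    = [set w | X 0 w = origin d].
  apply/seteqP; split => w /=; first by move=> /(_ 0%N isT); rewrite mul0r.
  by move=> X0 [|//] _; rewrite mul0r.
have -> : [set w | forall i, (i <= 1)%N -> X (i%:R * t) w = if i is 0 then origin d else ray_point k j]
    = [set w | X t w = ray_point k j] `&` [set w | X 0 w = origin d].
  apply/seteqP; split => w /=.
    by move=> h; have := h 0%N isT; have := h 1%N isT; rewrite mul0r mul1r.
  by move=> [Xt X0] [|[|//]] _; rewrite ?mul0r ?mul1r.
rewrite P0 mul1e mul1r subr0 => PE.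
rewrite /state_prob /cond_prob P0 PE /= ?divr1 //.
by move=> [|//] _; rewrite mul1r mul0r.
Qed.

End Chain.

Theorem proposition4p3 (R : realType) (disp : measure_display)
    (T : measurableType disp) (P : probability T R)
    (d : nat) (alpha lambda mu : R) (X : R -> T -> state d)
    (d_gt0 : (0 < d)%N) (lambda_gt0 : 0 < lambda)
    (alpha_eq : alpha = lambda) (lambda_eq : lambda = mu)
    (X_chain : is_markov_chain P X (rate alpha lambda mu) (origin d))
    (k : nat) (t : R) (k_gt0 : (0 < k)%N) (t_gt0 : 0 < t) (t_lt : t < 1 / lambda) :
  [/\ (forall n : nat, (0 < n)%N ->
         cvgn (fun m : nat => \sum_(0 <= r < m) inner_term (lambda * t) k n r)),
      cvgn (fun m : nat => \sum_(1 <= n < m) outer_term (lambda * t) d k n) &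
      level_prob P X k t =
        (lambda * t) ^+ k / (lambda * t + 1) ^+ k.+1
        * (d%:R + (d%:R - 1)
                  * \big[+%R/0]_(1 <= n <oo) outer_term (lambda * t) d k n)].
Proof.
have x01 : 0 < lambda * t < 1 by rewrite mulr_gt0 //= mulrC -ltr_pdivlMr.
split.
- by move=> n n0; apply/cvg_ex; eexists; exact: cvg_inner_series.
- exact: cvg_outer_series.
have [_ P0 [p [ptf prates markov]]] := X_chain.
rewrite /level_prob; under eq_bigr do rewrite (state_prob_transition _ _ P0 markov t_gt0).
move: prates; rewrite alpha_eq -lambda_eq => prates.
set x := lambda * t in x01 *; set a := fun n : nat => (cut_weight d n)%:R : R.
rewrite (addrC x) -/(geom k x).
set L := \big[+%R/0]_(1 <= n <oo) _.
have cL : (fun K => \sum_(1 <= n < K.+1) outer_term x d k n) @ \oo --> L.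
  by rewrite (cvg_shiftS (fun K => \sum_(1 <= n < K) outer_term x d k n)); exact: cvg_outer_series.
(* Both sides are the limit of the truncated series times [d]; the right one does not depend on [j],
   so all [d] states of the level are equally likely. *)
have pE j : d%:R * p t (origin d) (ray_point k j) = geom k x * (d%:R + (d%:R - 1) * L).
  have cW : (fun K => d%:R * level_approx a d%:R K k x) @ \oo --> geom k x * (d%:R + (d%:R - 1) * L).
    rewrite (_ : (fun K => _) = fun K => geom k x * (d%:R + (d%:R - 1) *
      \sum_(1 <= n < K.+1) outer_term x d k n)); last by apply/funext => K; exact: level_approxE.
    by apply: cvgMr; apply: cvgD; [exact: cvg_cst|exact: cvgMr].
  have cp : (fun K => d%:R * level_approx a d%:R K k x) @ \oo --> d%:R * p t (origin d) (ray_point k j).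
    apply: cvgMr; apply/cvgrPdist_le => e e0.
    have /cvgrPdist_le/(_ e e0) := cvg_approx_error d_gt0 x01; apply: filterS => K.
    rewrite sub0r normrN => /(le_trans _); apply; apply: le_trans (ler_norm _).
    (* [transition_approx] indexes the target by its place on the ray, one less than its level. *)
    rewrite -(prednK k_gt0).
    apply: (transition_approx d_gt0 lambda_gt0 ptf prates) => // n.
    exact: cut_weight_recR.
  exact: cvg_unique cp cW.
have d0 : d%:R != 0 :> R by rewrite pnatr_eq0 -lt0n.
rewrite (eq_bigr (fun=> geom k x * (d%:R + (d%:R - 1) * L) / d%:R)); last first.
  by move=> j _; rewrite -(pE j) mulrAC divff // mul1r.
by rewrite sumr_const card_ord -[LHS]mulr_natr divfK.
Qed.
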